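(* In the setting of the context (a Lie superalgebra $\mathfrak{g}=\mathfrak{g}_-\oplus\mathfrak{h}\oplus\mathfrak{g}_+$ satisfying assumptions (1)–(4), a subset $\Delta_+(\mathfrak{l})\subseteq\Delta_+$ with the stated Levi property, and coefficients $P_{\mathfrak{g},\mathfrak{l}}(\beta_1,\ldots,\beta_\ell)\in U'(\mathfrak{h})$ defined by the stated recursion), the relative extremal projector $P_{\mathfrak{g},\mathfrak{l}}:M\to M$ can be expressed, as an operator on $M$, as $$P_{\mathfrak{g},\mathfrak{l}}=1+\sum_{\ell=1}^\infty\ \sum_{(\beta_1,\ldots,\beta_\ell)\in(\Delta_+)^\ell}P_{\mathfrak{g},\mathfrak{l}}(\beta_1,\ldots,\beta_\ell)\sum_{i_1\in I_{\beta_1},\ldots,i_\ell\in I_{\beta_\ell}}f_{\beta_1}^{i_1}\cdots f_{\beta_\ell}^{i_\ell}\,e_{\beta_\ell}^{i_\ell}\cdots e_{\beta_1}^{i_1}.$$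
   Context: Setting. $\mathbb{F}$ is a field of characteristic $0$; $\mathfrak{g}$ is a (not necessarily finite-dimensional) Lie superalgebra over $\mathbb{F}$ with a vector superspace decomposition into three subalgebras $\mathfrak{g}=\mathfrak{g}_-\oplus\mathfrak{h}\oplus\mathfrak{g}_+$ such that: (1) $\mathfrak{h}=\mathfrak{h}_{\bar0}$ (purely even) and $\mathfrak{h}$ is maximal abelian in $\mathfrak{g}$; (2) $\mathfrak{g}_+$ and $\mathfrak{g}_-$ have bases $\{e^i_\beta\}_{\beta\in\Delta_+,i\in I_\beta}$ and $\{f^i_\beta\}_{\beta\in\Delta_+,i\in I_\beta}$ of homogeneous weight vectors, where $\Delta_+\subseteq\mathfrak{h}^\ast$ and the $I_\beta$ are index sets: $[h,e^i_\beta]=\beta(h)e^i_\beta$, $[h,f^i_\beta]=-\beta(h)f^i_\beta$ for all $h\in\mathfrak{h}$; (3) there is $\Omega_0\in U(\mathfrak{h})$ such that $\Omega=\Omega_0+\sum_{\beta\in\Delta_+}\sum_{i\in I_\beta}f^i_\beta e^i_\beta$ defines an operator on $U(\mathfrak{g})/U(\mathfrak{g})\mathfrak{g}_+$ commuting with the action of $U(\mathfrak{g})$; in particular for each $v\in U(\mathfrak{g})/U(\mathfrak{g})\mathfrak{g}_+$, $f^i_\beta e^i_\beta v$ is nonzero for at most finitely many $(\beta,i)$; (4) any element of $U(\mathfrak{g})$ commuting with $\Omega_0$ also commutes with all of $\mathfrak{h}$. Let $Q_+=\mathbb{Z}_{\ge0}\Delta_+\subseteq\mathfrak{h}^\ast$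 and $Q_{\succ0}=Q_+\setminus\{0\}$. The relation $\lambda\preceq\mu\iff\mu-\lambda\in Q_+$ is a partial order on $\mathfrak{h}^\ast$, and $\Delta_+\subseteq Q_{\succ0}$. Let $S=U(\mathfrak{h})\setminus\{0\}$, $U'(\mathfrak{g})=S^{-1}U(\mathfrak{g})$ (Ore localization), and $U'(\mathfrak{h})\subseteq U'(\mathfrak{g})$ the fraction field of $U(\mathfrak{h})$. For $\lambda\in\mathfrak{h}^\ast$, $\phi\mapsto\phi^\lambda$ is the unital $\mathbb{F}$-algebra automorphism of $U'(\mathfrak{h})$ determined by $h^\lambda=h+\lambda(h)$, $h\in\mathfrak{h}$. For $\lambda\in Q_{\succ0}$ the element $\Omega_0^\lambda-\Omega_0$ is nonzero, and $\psi_\lambda=\frac{1}{\Omega_0^\lambda-\Omega_0}\in U'(\mathfrak{h})$; $\psi_\lambda^\mu=(\psi_\lambda)^\mu$. Let $M=U'(\mathfrak{g})/U'(\mathfrak{g})\mathfrak{g}_+$ (localized universal Verma module), a $(U'(\mathfrak{g}),U'(\mathfrak{h}))$-bimodule. With the adjoint action $h\cdot m=hm-mh$, $M=\bigoplus_{\lambda\in Q_+}M_{-\lambda}$ where $M_{-\lambda}=\{m\in M\mid h\cdot m=-\lambda(h)m\ \forall h\in\mathfrak{h}\}$. Relative data. $\Delta_+(\mathfrak{l})\subseteq\Delta_+$ is a subset such that whenever $\beta_1,\ldots,\beta_k\in\Delta_+$ and $\beta_1+\cdots+\beta_k\in\mathbb{Z}_{\ge0}\Delta_+(\mathfrak{l})$,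 then all $\beta_i\in\Delta_+(\mathfrak{l})$. The Levi subalgebra $\mathfrak{l}$ is the span of $\mathfrak{h}$ and all $e^i_\beta,f^i_\beta$ with $\beta\in\Delta_+(\mathfrak{l})$. The Levi cone is $Q_+(\mathfrak{l})=\mathbb{Z}_{\ge0}\Delta_+(\mathfrak{l})$. The relative extremal projector $P_{\mathfrak{g},\mathfrak{l}}:M\to M$ is the linear operator equal to the identity on $M_{-\lambda}$ for $\lambda\in Q_+(\mathfrak{l})$ and to zero on $M_{-\lambda}$ for $\lambda\in Q_+\setminus Q_+(\mathfrak{l})$. Coefficients. For $\ell\ge1$ and $\beta_1,\ldots,\beta_\ell\in Q_{\succ0}$ put $$E(\beta_1,\ldots,\beta_\ell)=\psi_{\beta_1+\cdots+\beta_\ell}\,\psi^{\beta_1}_{\beta_2+\cdots+\beta_\ell}\cdots\psi^{\beta_1+\cdots+\beta_{\ell-1}}_{\beta_\ell}\in U'(\mathfrak{h}).$$ For $\ell\ge0$ and $\beta_1,\ldots,\beta_\ell\in Q_{\succ0}$ define $P_{\mathfrak{g},\mathfrak{l}}(\beta_1,\ldots,\beta_\ell)\in U'(\mathfrak{h})$ recursively: $P_{\mathfrak{g},\mathfrak{l}}(\emptyset)=1$; if $\ell>0$ and all $\beta_i\in Q_+(\mathfrak{l})$, then $P_{\mathfrak{g},\mathfrak{l}}(\beta_1,\ldots,\beta_\ell)=0$; if $\ell>0$ and at least one $\beta_i\notin Q_+(\mathfrak{l})$, then $$P_{\mathfrak{g},\mathfrak{l}}(\beta_1,\ldots,\beta_\ell)=-\sum_{k=0}^{\ell-1}P_{\mathfrak{g},\mathfrak{l}}(\beta_1,\ldots,\beta_k)\,E(\beta_{k+1},\ldots,\beta_\ell)^{\beta_1+\cdots+\beta_k}.$$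 Elements of $U'(\mathfrak{g})$ act on $M$ by left multiplication, and infinite sums of operators on $M$ are understood pointwise (on each vector only finitely many terms are nonzero).
   Formalization: Pointwise finiteness is a hypothesis: for each m in M only finitely many products f…f e…e m (over all ℓ, β's and i's, taken without coefficients) are nonzero. It does not follow from (1)–(4), and without it the infinite sum can be undefined. *)

(* Defs.v *)
From HB Require Import structures.
From mathcomp Require Import all_boot all_order all_algebra.
From mathcomp Require Import all_classical.
Set Implicit Arguments.
Unset Strict Implicit.
Unset Printing Implicit Defensive.
Import GRing.Theory.
Local Open Scope classical_set_scope.
Local Open Scope ring_scope.

(* [par false] is the even part and [par true] the odd part.                  *)

Definition subspace (F : fieldType) (V : lmodType F) (W : set V) : Prop :=
  W 0 /\ forall (a : F) x y, W x -> W y -> W (a *: x + y).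

Definition superspace (F : fieldType) (V : lmodType F)
    (par : bool -> set V) : Prop :=
  (forall b, subspace (par b)) /\
  (forall x, exists! t : V * V,
     [/\ par false t.1, par true t.2 & x = t.1 + t.2]).

Definition lie_superalgebra (F : fieldType) (g : lmodType F)
    (par : bool -> set g) (br : g -> g -> g) : Prop :=
  [/\ superspace par,
      (forall (a : F) x y z, br (a *: x + y) z = a *: br x z + br y z) /\
      (forall (a : F) x y z, br z (a *: x + y) = a *: br z x + br z y),
      (forall a b x y, par a x -> par b y -> par (a (+) b) (br x y)),
      (forall a b x y, par a x -> par b y ->
         br x y = - ((-1) ^+ (a && b) *: br y x)) &
      (forall a b x y z, par a x -> par b y ->
         br x (br y z) =
         br (br x y) z + (-1) ^+ (a && b) *: br y (br x z))].

Definition subsuperalgebra (F : fieldType) (g : lmodType F)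
    (par : bool -> set g) (br : g -> g -> g) (W : set g) : Prop :=
  [/\ subspace W,
      (forall x, W x -> exists x0 x1,
         [/\ par false x0 /\ W x0, par true x1 /\ W x1 & x = x0 + x1]) &
      (forall x y, W x -> W y -> W (br x y))].

Definition abelian_set (F : fieldType) (g : lmodType F)
    (br : g -> g -> g) (W : set g) : Prop :=
  forall x y, W x -> W y -> br x y = 0.

Definition maximal_abelian (F : fieldType) (g : lmodType F)
    (par : bool -> set g) (br : g -> g -> g) (W : set g) : Prop :=
  [/\ subsuperalgebra par br W, abelian_set br W &
      (forall W', subsuperalgebra par br W' -> abelian_set br W' ->
         W `<=` W' -> W' = W)].

Definition direct_sum3 (F : fieldType) (g : lmodType F)
    (A B C : set g) : Prop :=
  forall x, exists! t : g * g * g,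
    [/\ A t.1.1, B t.1.2, C t.2 & x = t.1.1 + t.1.2 + t.2].

Definition is_basis (F : fieldType) (V : lmodType F) (J : choiceType)
    (D : set J) (b : J -> V) (W : set V) : Prop :=
  [/\ subspace W,
      (forall j, D j -> W (b j)),
      (forall w, W w -> exists (s : seq J) (c : J -> F),
         (forall j, j \in s -> D j) /\ w = \sum_(j <- s) c j *: b j) &
      (forall (s : seq J) (c : J -> F), uniq s -> (forall j, j \in s -> D j) ->
         \sum_(j <- s) c j *: b j = 0 -> forall j, j \in s -> c j = 0)].

(* The Cartan subalgebra is a vector space [h] embedded in [g]; h^* consists  *)
(* of the linear functions in the function space [h -> F].                    *)

Definition linear_weight (F : fieldType) (h : lmodType F) (l : h -> F) : Prop :=
  forall (a : F) x y, l (a *: x + y) = a * l x + l y.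

Definition wsum (F : fieldType) (h : lmodType F) (b : seq (h -> F)) : h -> F :=
  \sum_(l <- b) l.

(* The monoid Z_{>=0} D generated by a set of weights.                        *)
Definition cone (F : fieldType) (h : lmodType F) (D : set (h -> F)) :
    set (h -> F) :=
  [set l | exists b, (forall x, x \in b -> D x) /\ l = wsum b].

Definition wle (F : fieldType) (h : lmodType F) (D : set (h -> F))
    (l m : h -> F) : Prop :=
  cone D (m - l).

(* Enveloping algebras, quotient modules and rings of fractions are given by  *)
(* the properties that determine them up to unique isomorphism.               *)

Definition super_representation (F : fieldType) (g : lmodType F)
    (par : bool -> set g) (br : g -> g -> g) (A : algType F)
    (phi : {linear g -> A}) : Prop :=
  forall a b x y, par a x -> par b y ->
    phi (br x y) = phi x * phi y - (-1) ^+ (a && b) * (phi y * phi x).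

Definition enveloping_algebra (F : fieldType) (g : lmodType F)
    (par : bool -> set g) (br : g -> g -> g) (U : algType F)
    (i : {linear g -> U}) : Prop :=
  super_representation par br i /\
  (forall (A : algType F) (phi : {linear g -> A}),
     super_representation par br phi ->
     exists Phi : {lrmorphism U -> A}, (forall x, Phi (i x) = phi x) /\
       (forall Psi : {lrmorphism U -> A},
          (forall x, Psi (i x) = phi x) -> Psi =1 Phi)).

Definition subalgebra (F : fieldType) (A : algType F) (S : set A) : Prop :=
  [/\ S 1, (forall (a : F) x y, S x -> S y -> S (a *: x + y)) &
      (forall x y, S x -> S y -> S (x * y))].

Definition subalgebra_generated (F : fieldType) (A : algType F) (X : set A) :
    set A :=
  smallest (@subalgebra F A) X.

Definition left_ideal (R : pzRingType) (S : set R) : Prop :=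
  [/\ S 0, (forall x y, S x -> S y -> S (x + y)) &
      (forall r x, S x -> S (r * x))].

Definition left_ideal_generated (R : pzRingType) (X : set R) : set R :=
  smallest (@left_ideal R) X.

(* [p] identifies the left module [M] with R / N.                             *)
Definition quotient_map (R : pzRingType) (N : set R) (M : lmodType R)
    (p : {linear R^o -> M}) : Prop :=
  (forall m, exists x, p x = m) /\ (forall x, p x = 0 <-> N x).

Definition ore_localization (F : fieldType) (A : algType F) (S : set A)
    (B : unitAlgType F) (j : {lrmorphism A -> B}) : Prop :=
  [/\ (forall s, S s -> j s \is a GRing.unit),
      (forall x, exists s a, S s /\ x = (j s)^-1 * j a) &
      (forall a, j a = 0 <-> exists2 s, S s & s * a = 0)].

Definition nonzero (A : nmodType) (X : set A) : set A :=
  [set s | X s /\ s <> 0].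

Definition fractions (F : fieldType) (A : algType F) (X : set A)
    (B : unitAlgType F) (j : {lrmorphism A -> B}) : set B :=
  [set x | exists s a, [/\ nonzero X s, X a & x = (j s)^-1 * j a]].

Definition algebra_automorphism_on (F : fieldType) (B : algType F)
    (K : set B) (t : B -> B) : Prop :=
  [/\ set_bij K K t,
      t 1 = 1,
      (forall (a : F) x y, K x -> K y -> t (a *: x + y) = a *: t x + t y) &
      (forall x y, K x -> K y -> t (x * y) = t x * t y)].

(* [sh l x] is x^l; only its values for l in h^* and x in [K] = U'(h) are     *)
(* constrained, and [ih] is the canonical map from h to U'(h).                *)
Definition weight_shifts (F : fieldType) (h : lmodType F) (B : algType F)
    (K : set B) (ih : h -> B) (sh : (h -> F) -> B -> B) : Prop :=
  forall l, linear_weight l ->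
    algebra_automorphism_on K (sh l) /\
    (forall x, sh l (ih x) = ih x + (l x)%:A).

(* An element of [rootindex I] is a pair (beta, i) with i in I_beta.          *)

Definition rootindex (F : fieldType) (h : lmodType F)
    (I : (h -> F) -> choiceType) : choiceType := {b : h -> F & I b}.

Definition weights_of (F : fieldType) (h : lmodType F)
    (I : (h -> F) -> choiceType) (s : seq (rootindex I)) : seq (h -> F) :=
  [seq tag x | x <- s].

(* f_{beta_1} ... f_{beta_l} e_{beta_l} ... e_{beta_1}                        *)
Definition fe_monomial (F : fieldType) (h : lmodType F)
    (I : (h -> F) -> choiceType) (B : pzRingType) (e f : rootindex I -> B)
    (s : seq (rootindex I)) : B :=
  (\prod_(x <- s) f x) * (\prod_(x <- rev s) e x).

Definition casimir (F : fieldType) (h : lmodType F)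
    (I : (h -> F) -> choiceType) (D : set (h -> F)) (U : algType F)
    (e f : rootindex I -> U) (Omega0 : U) (V : lmodType U) (v : V) : V :=
  Omega0 *: v + \sum_(x \in [set x | D (tag x)]) (f x * e x) *: v.

(* [Om] is the image of Omega_0 in B = U'(g).  The inverse is that of B; the  *)
(* elements sh l Om are meaningful for l in h^*.                              *)

Definition psi (F : fieldType) (h : lmodType F) (B : unitAlgType F)
    (sh : (h -> F) -> B -> B) (Om : B) (l : h -> F) : B :=
  (sh l Om - Om)^-1.

Definition Ecoef (F : fieldType) (h : lmodType F) (B : unitAlgType F)
    (sh : (h -> F) -> B -> B) (Om : B) (b : seq (h -> F)) : B :=
  \prod_(k < size b) sh (wsum (take k b)) (psi sh Om (wsum (drop k b))).

(* [n] bounds the recursion depth; [size b] is enough, see [Pcoef_rec].       *)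
Fixpoint Pcoef_fuel (F : fieldType) (h : lmodType F) (B : unitAlgType F)
    (sh : (h -> F) -> B -> B) (Om : B) (Ql : set (h -> F)) (n : nat)
    (b : seq (h -> F)) : B :=
  if n is n'.+1 then
    if b is [::] then 1
    else if all (fun l => l \in Ql) b then 0
    else - \sum_(k < size b) Pcoef_fuel sh Om Ql n' (take k b) *
                             sh (wsum (take k b)) (Ecoef sh Om (drop k b))
  else 1.

Definition Pcoef (F : fieldType) (h : lmodType F) (B : unitAlgType F)
    (sh : (h -> F) -> B -> B) (Om : B) (Ql : set (h -> F))
    (b : seq (h -> F)) : B :=
  Pcoef_fuel sh Om Ql (size b) b.

Lemma Pcoef_fuel_stable (F : fieldType) (h : lmodType F) (B : unitAlgType F)
    (sh : (h -> F) -> B -> B) (Om : B) (Ql : set (h -> F)) n b :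
  (size b <= n)%N -> Pcoef_fuel sh Om Ql n b = Pcoef sh Om Ql b.
Proof.
rewrite /Pcoef; move: {2}(size b) (leqnn (size b)) => N.
elim: N n b => [|N IH] [|n] [|l b] //= leN len.
case: ifP => // _; congr (- _); apply: eq_bigr => -[k /= ltk] _.
have szk : size (take k (l :: b)) = k by apply/size_takel/ltnW.
have kN : (k <= N)%N := leq_trans ltk leN.
have kn : (k <= n)%N := leq_trans ltk len.
by congr (_ * _); rewrite !IH // szk.
Qed.

Lemma Pcoef_nil (F : fieldType) (h : lmodType F) (B : unitAlgType F)
    (sh : (h -> F) -> B -> B) (Om : B) (Ql : set (h -> F)) :
  Pcoef sh Om Ql [::] = 1.
Proof. by []. Qed.

Lemma Pcoef_levi (F : fieldType) (h : lmodType F) (B : unitAlgType F)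
    (sh : (h -> F) -> B -> B) (Om : B) (Ql : set (h -> F)) b :
  b != [::] -> (forall l, l \in b -> Ql l) -> Pcoef sh Om Ql b = 0.
Proof.
case: b => [//|l b] _ lQ; rewrite /Pcoef /=.
have /= -> // : all (fun l => l \in Ql) (l :: b).
by apply/allP => x xb; rewrite inE; apply: (lQ x xb).
Qed.

Lemma Pcoef_rec (F : fieldType) (h : lmodType F) (B : unitAlgType F)
    (sh : (h -> F) -> B -> B) (Om : B) (Ql : set (h -> F)) b :
  (exists2 l, l \in b & ~ Ql l) ->
  Pcoef sh Om Ql b =
  - \sum_(k < size b) Pcoef sh Om Ql (take k b) *
                      sh (wsum (take k b)) (Ecoef sh Om (drop k b)).
Proof.
case: b => [[]//|l b] [x xb xQ]; rewrite {1}/Pcoef /=.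
have /negbTE -> : ~~ ((l \in Ql) && all (fun l => l \in Ql) b).
  apply/negP => allQ; have /allP/(_ x xb) : all (fun l => l \in Ql) (l :: b).
    exact: allQ.
  by rewrite inE.
congr (- _); apply: eq_bigr => -[k /= ltk] _; congr (_ * _).
by apply: Pcoef_fuel_stable; rewrite size_takel // ltnW.
Qed.

(* [p] presents M as a quotient of B = U'(g).  The right action of U'(h) on M *)
(* is induced by right multiplication in B, (p u) a = p (u * a), so that      *)
(* [ih x *: m - p (u * ih x)] is the adjoint action of x on m = p u.          *)

Definition weight_space (F : fieldType) (h : lmodType F) (B : unitAlgType F)
    (ih : h -> B) (M : lmodType B) (p : {linear B^o -> M}) (l : h -> F) :
    set M :=
  [set m | forall u : B, p u = m ->
     forall x : h, ih x *: m - p (u * ih x) = (l x)%:A *: m].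

Definition relative_extremal_projector (F : fieldType) (h : lmodType F)
    (B : unitAlgType F) (ih : h -> B) (M : lmodType B)
    (p : {linear B^o -> M}) (D Dl : set (h -> F)) (P : M -> M) : Prop :=
  [/\ (forall m n, P (m + n) = P m + P n),
      (forall (a : F) m, P (a%:A *: m) = a%:A *: P m),
      (forall l m, cone Dl l -> weight_space ih p (- l) m -> P m = m) &
      (forall l m, cone D l -> ~ cone Dl l -> weight_space ih p (- l) m ->
         P m = 0)].

(* Main.v *)
Require Import Defs.
From HB Require Import structures.
From mathcomp Require Import all_boot all_order all_algebra.
From mathcomp Require Import finmap.
From mathcomp Require Import all_classical.
Set Implicit Arguments.
Unset Strict Implicit.
Unset Printing Implicit Defensive.
Import GRing.Theory.
Local Open Scope classical_set_scope.
Local Open Scope ring_scope.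

(** Let m be a vector of M of weight - l.  Since the Casimir operator commutes
    with U'(g) and acts on the generator of M by Omega_0, the sum of the f e m
    over all root vectors is (Omega_0^l - Omega_0) m ([casimir_verma]).  For
    l <> 0 the factor is invertible on a nonzero weight space
    ([shift_Omega0_neq]), so m = psi_l (sum of f e m), and e m has weight
    - (l - beta).  Iterating under the f's, the vector
    t(s) = f_1 ... f_n e_n ... e_1 m of a word s satisfies
    t(s) = psi^(wt s)_(l - wt s) (sum of t(s x) over root vectors x), until
    wt s = l, when the sum is 0 ([casimir_descent]).  The coefficients met on
    the way from a word to an extension of total weight l multiply up to the
    shifted coefficient E of the added letters ([shift_Ecoef]).

    Suppose l is outside the Levi cone.  Rewriting the sum of the P(s) t(s) in
    terms of the words of total weight l gives each of them the coefficient
    P(s) + (sum over proper prefixes r of P(r) times the shifted E of the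
    rest).  At least one root of s is outside the Levi cone, so this is 0 by
    the recursion defining P: the series kills m ([telescope_words],
    [expansion_off_cone]).  If l is in the Levi cone, only words of Levi roots
    contribute, P vanishes on them unless the word is empty, and the series
    returns m ([expansion_on_cone]).

    It remains that M is the sum of its weight spaces with weights in minus
    the positive cone, and that weights are independent ([fword_span_all],
    [weight_rep_independent]).  For the first, M is spanned by words in the f's
    times fractions, because the supercommutation relations make that span
    stable under g, and the universal property of U(g) does the rest.  Invertibility of
    Omega_0^l - Omega_0 is established only for weights that occur in M,
    where a nonzero word of f's of weight l is available to be tested
    against the assumption on elements commuting with Omega_0. *)

(** * Induction on an enveloping algebra *)

Definition subalg_mem (F : fieldType) (A : algType F) (S : set A)
  of subalgebra S : {pred A} := fun x => `[< S x >].

(** A subalgebra has to become an [algType] before the universal property of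
    U(g) can be applied to it. *)
Record subalg_type (F : fieldType) (A : algType F) (S : set A)
    (algS : subalgebra S) :=
  SubalgType { subalg_val : A; _ : subalg_val \in subalg_mem algS }.

Section SubalgebraType.
Variables (F : fieldType) (A : algType F) (S : set A) (algS : subalgebra S).

Fact subalg_mem_closed : GRing.subalg_closed (subalg_mem algS).
Proof.
have [S1 SZ SM] := algS; split; first exact/asboolP.
- by move=> a x y /asboolP Sx /asboolP Sy; apply/asboolP; apply: SZ.
- by move=> x y /asboolP Sx /asboolP Sy; apply/asboolP; apply: SM.
Qed.

HB.instance Definition _ := [isSub of subalg_type algS for @subalg_val F A S algS].
HB.instance Definition _ := [Choice of subalg_type algS by <:].
HB.instance Definition _ :=
  GRing.SubChoice_isSubAlgebra.Build F A (subalg_mem algS) (subalg_type algS)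
    (GRing.subalg_closed_semi subalg_mem_closed).

Definition subalg_incl : {lrmorphism subalg_type algS -> A} :=
  let incl : subalg_type algS -> A := val in
  HB.pack incl
    (GRing.RMorphism.class (incl : {rmorphism subalg_type algS -> A}))
    (GRing.Linear.class (incl : {linear subalg_type algS -> A})).

End SubalgebraType.

(** The universal property gives a morphism from U(g) to the subalgebra S;
    followed by the inclusion of S it is an endomorphism of U(g) that fixes g,
    hence the identity. *)
Lemma enveloping_algebra_ind (F : fieldType) (g : lmodType F)
    (par : bool -> set g) (br : g -> g -> g) (U : algType F)
    (i : {linear g -> U}) (S : set U) :
  enveloping_algebra par br i -> subalgebra S -> (forall x, S (i x)) ->
  forall u, S u.
Proof.
move=> [i_rep i_univ] algS Si u.
have mem_i x : i x \in subalg_mem algS by apply/asboolP.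
pose phi x : subalg_type algS := SubalgType (mem_i x).
have phi_lin : linear phi by move=> a x y; apply: val_inj; rewrite /= linearP.
pose phiL := GRing.isLinear.Build _ _ _ _ phi phi_lin.
pose phi' : {linear g -> subalg_type algS} := HB.pack phi phiL.
have phi_rep : super_representation par br phi'.
  move=> a b x y xa yb; apply: val_inj.
  rewrite [RHS]rmorphB !rmorphM rmorphXn rmorphN1.
  exact: i_rep.
have [Phi [PhiE _]] := i_univ _ _ phi_rep.
have [Psi [PsiE Psi_uniq]] := i_univ _ _ i_rep.
have idE : idfun u = Psi u by apply: (Psi_uniq idfun).
have valE : (subalg_incl algS \o Phi) u = Psi u.
  by apply: (Psi_uniq (subalg_incl algS \o Phi)) => x; rewrite /= PhiE.
rewrite -[u]/(idfun u) idE -valE.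
by apply/asboolP; apply: (valP (Phi u)).
Qed.

(** * Finitely supported sums *)

Lemma fsum_finite (I : choiceType) (V : nmodType) (Z A : set I) (G : I -> V) :
  finite_set Z -> Z `<=` A -> (forall x, A x -> G x <> 0 -> Z x) ->
  \sum_(x \in A) G x = \sum_(x <- fset_set Z) G x.
Proof.
move=> finZ ZA GZ; rewrite -fsbig_finite //; apply/esym/fsbig_widen => // x [Ax].
by apply: contra_notP; exact: GZ.
Qed.

Lemma scaler_fsum (I : choiceType) (B : pzRingType) (M : lmodType B) (a : B)
    (A : set I) (G : I -> M) :
  finite_set (A `&` [set x | G x <> 0]) ->
  a *: (\sum_(x \in A) G x) = \sum_(x \in A) a *: G x.
Proof.
move=> finG; rewrite (fsum_finite finG) //.
rewrite (@fsum_finite _ _ _ _ (fun x => a *: G x) finG) //.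
- by rewrite scaler_sumr.
- by move=> x Ax aGx; split=> // Gx; apply: aGx; rewrite Gx scaler0.
Qed.

Lemma fsumD (I : choiceType) (V : nmodType) (A : set I) (G H : I -> V) :
  finite_set (A `&` [set x | G x <> 0]) -> finite_set (A `&` [set x | H x <> 0]) ->
  \sum_(x \in A) (G x + H x) = \sum_(x \in A) G x + \sum_(x \in A) H x.
Proof.
move=> finG finH.
have finGH := conj finG finH; rewrite -finite_setU in finGH.
have sub : A `&` [set x | G x <> 0] `|` A `&` [set x | H x <> 0] `<=` A.
  by move=> x [] [].
rewrite !(fsum_finite finGH) ?big_split //.
- by move=> x Ax ?; right.
- by move=> x Ax ?; left.
- move=> x Ax GHx; apply: contrapT => /not_orP[] /not_andP[//|/contrapT Gx].
  by case/not_andP=> // /contrapT Hx; apply: GHx; rewrite Gx Hx addr0.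
Qed.

Lemma fsumD1 (I : choiceType) (V : nmodType) (x0 : I) (A : set I) (G : I -> V) :
  finite_set (A `&` [set x | G x <> 0]) -> A x0 ->
  \sum_(x \in A) G x = G x0 + \sum_(x \in A `\ x0) G x.
Proof.
set Z := _ `&` _ => finZ Ax0.
have finZ0 : finite_set (x0 |` Z) by rewrite finite_setU; split.
rewrite -(@fsbig_widen _ _ _ _ (x0 |` Z) A); first last.
- by move=> x [Ax] /not_orP[_] /not_andP[//|/contrapT].
- by move=> x [->|[]].
rewrite (fsbigD1 x0) //; last by left.
congr (_ + _); apply: fsbig_widen.
- by move=> x [[xx0|[Ax _]] nx]; split=> //; case: nx.
- move=> x [[Ax nx]] Zx; apply: contrapT => Gx; apply: Zx.
  by split=> //; right.
Qed.

Lemma fsum_fiber (I J : choiceType) (V : nmodType) (A : set I) (C : set J)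
    (k : I -> J) (G : I -> V) :
  finite_set (A `&` [set x | G x <> 0]) -> (forall x, A x -> C (k x)) ->
  \sum_(x \in A) G x =
  \sum_(y \in C) \sum_(x \in A `&` [set x | k x = y]) G x.
Proof.
set Z := _ `&` _ => finZ kC.
have ZA : Z `<=` A by move=> x [].
have fiberE y : \sum_(x \in A `&` [set x | k x = y]) G x =
                \sum_(x <- fset_set Z | k x == y) G x.
  rewrite (@fsum_finite _ _ (Z `&` [set x | k x = y])).
  - rewrite -[RHS]big_filter; apply: perm_big; apply: uniq_perm.
    + exact: fset_uniq.
    + by rewrite filter_uniq // fset_uniq.
    + move=> x; rewrite mem_filter !in_fset_set //; last exact: finite_setIl.
      by rewrite in_setI andbC; congr andb; apply/idP/eqP; rewrite inE.
  - exact: finite_setIl.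
  - by move=> x [/ZA ? ?]; split.
  - by move=> x [Ax kx] Gx; split.
rewrite (eq_fsbigr _ _ (fun y _ => fiberE y)).
rewrite (@fsum_finite _ _ (k @` Z)).
- rewrite (fsum_finite finZ) //.
  by rewrite (partition_big_imfset _ k) /= fset_set_image //.
- exact: finite_image.
- by move=> _ [x /ZA Ax <-]; exact: kC.
- move=> y Cy; apply: contra_notP => kZ; apply: big1_seq => x /andP[/eqP kx].
  rewrite in_fset_set // inE => Zx; case: kZ; by exists x.
Qed.

(** * Sums over words *)

Definition words (I : eqType) (D : set I) : set (seq I) :=
  [set s | forall x, x \in s -> D x].

Lemma words_cons (I : eqType) (D : set I) x s :
  words D (x :: s) <-> D x /\ words D s.
Proof.
split=> [Ds|[Dx Ds] y]; last by rewrite inE => /orP[/eqP->|/Ds].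
by split=> [|y ys]; apply: Ds; rewrite inE ?eqxx ?ys ?orbT.
Qed.

Lemma words_rcons (I : eqType) (D : set I) s x :
  words D (rcons s x) <-> words D s /\ D x.
Proof.
split=> [Dsx|[Ds Dx] y].
  split=> [y ys|]; apply: Dsx; rewrite mem_rcons inE ?eqxx //.
  by rewrite ys orbT.
by rewrite mem_rcons inE => /orP[/eqP-> //|/Ds].
Qed.

Section Telescope.
Variables (I : choiceType) (D : set I) (B : pzRingType) (M : lmodType B).
Variables (t : seq I -> M).
Hypothesis t_fin : finite_set (words D `&` [set s | t s <> 0]).

Lemma scale_words_fin (a : seq I -> B) :
  finite_set (words D `&` [set s | a s *: t s <> 0]).
Proof.
apply: sub_finite_set t_fin => s [Ds ts]; split=> // ts0.
by apply: ts; rewrite /= ts0 scaler0.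
Qed.

Lemma words_ext_fin s : words D s -> finite_set (D `&` [set x | t (rcons s x) <> 0]).
Proof.
move=> Ds; have -> : D `&` [set x | t (rcons s x) <> 0] =
    rcons s @^-1` (words D `&` [set s | t s <> 0]).
  apply/seteqP; split=> x /= [] Dx tx; split=> //; first by apply/words_rcons.
  by case/words_rcons: Dx.
by apply: finite_preimage t_fin => x y _ _ /rcons_inj[].
Qed.

(** The tail of a telescope: a sum that vanishes at the empty word can be
    indexed by the word with its last letter removed, and that letter. *)
Lemma fsum_words_rcons (a : seq I -> B) : a [::] = 0 ->
  \sum_(s \in words D) a s *: t s =
  \sum_(s \in words D) \sum_(x \in D) a (rcons s x) *: t (rcons s x).
Proof.
move=> a0; pose W1 := words D `&` [set s | s <> [::]].
rewrite -(@fsbig_widen _ _ _ _ W1); first last.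
- move=> s [Ds] /not_andP[//|/contrapT ->].
  by rewrite /= a0 scale0r.
- by move=> s [].
(* removes the last letter *)
pose k (s : seq I) := rev (behead (rev s)).
have kE s x : k (rcons s x) = s by rewrite /k rev_rcons /= revK.
rewrite (@fsum_fiber _ _ _ _ (words D) k); first last.
- by case/lastP => [|s x] [// Dsx _]; rewrite kE; case/words_rcons: Dsx.
- by apply: sub_finite_set (scale_words_fin a) => s [[]].
apply: eq_fsbigr => s; rewrite inE => Ds.
rewrite -(fsbig_image _ (rcons s) (fun r => a r *: t r)); last first.
  by move=> x y _ _ /rcons_inj[].
apply: eq_fsbigl; apply/seteqP; split.
  case/lastP => [|r x] [[Dr //] _]; rewrite /= kE => <-.
  by exists x => //; case/words_rcons: Dr.
move=> _ [x Dx <-]; split; rewrite /= ?kE //.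
by split=> [|/(congr1 size)]; [apply/words_rcons|rewrite size_rcons].
Qed.

(** Think of t as solving t s = c s * (sum of t over the one-letter extensions
    of s) until a word stops.  Expanding every term P s * t s until all its
    words have stopped collects, at a word s, the coefficient P s plus the
    coefficient A s carried over from the proper prefixes of s.  No word is
    followed to its end here: both sides of the recursion are summed at once,
    and the sum of A s * t s cancels. *)
Lemma telescope_words (P A c : seq I -> B) (stop : set (seq I)) :
  A [::] = 0 -> (forall s x, A (rcons s x) = (A s + P s) * c s) ->
  (forall s, words D s -> stop s ->
     P s + A s = 0 /\ \sum_(x \in D) t (rcons s x) = 0) ->
  (forall s, words D s -> ~ stop s ->
     t s = c s *: \sum_(x \in D) t (rcons s x)) ->
  \sum_(s \in words D) P s *: t s = 0.
Proof.
move=> A0 AS tstop tgo; apply: (addrI (\sum_(s \in words D) A s *: t s)).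
rewrite addr0 -fsumD; try exact: scale_words_fin.
rewrite [RHS]fsum_words_rcons //; apply: eq_fsbigr => s; rewrite inE => Ds.
rewrite -scalerDl.
under [RHS]eq_fsbigr do rewrite AS.
rewrite -scaler_fsum; last exact: words_ext_fin.
have [ss|nss] := pselect (stop s).
  have [PA ->] := tstop s Ds ss; rewrite scaler0.
  by rewrite addrC PA scale0r.
by rewrite {1}(tgo s Ds nss) scalerA.
Qed.

End Telescope.

(** The bridge between one sum over all words of indexed roots and the
    threefold sum over lengths, sequences of roots and indices. *)
Lemma fsum_words_fiber (I J : choiceType) (D : set J) (k : I -> J)
    (B : pzRingType) (M : lmodType B) (a : seq J -> B) (t : seq I -> M) :
  finite_set (words (k @^-1` D) `&` [set s | t s <> 0]) ->
  \sum_(s \in words (k @^-1` D)) a (map k s) *: t s =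
  a [::] *: t [::] +
  \sum_(l \in [set l | (1 <= l)%N])
    \sum_(b \in [set b : seq J | size b = l /\ forall y, y \in b -> D y])
      a b *: \sum_(s \in [set s | map k s = b]) t s.
Proof.
move=> t_fin; pose G s := a (map k s) *: t s.
have sub_fin (A : set (seq I)) : A `<=` words (k @^-1` D) ->
    finite_set (A `&` [set s | G s <> 0]).
  move=> AW; apply: sub_finite_set (scale_words_fin t_fin (a \o map k)).
  by move=> s [/AW ? ?]; split.
rewrite (@fsumD1 _ _ [::]) //; last exact: sub_fin.
congr (_ + _).
rewrite (@fsum_fiber _ _ _ _ [set l | (1 <= l)%N] size); first last.
- by case=> [|x s] [_ n0] //; case: n0.
- by apply: sub_fin => s [].
apply: eq_fsbigr => l; rewrite inE /= => l1.
rewrite (@fsum_fiber _ _ _ _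
  [set b : seq J | size b = l /\ forall y, y \in b -> D y] (map k)); first last.
- move=> s [[Ds _] /= sl]; split; first by rewrite size_map.
  by move=> _ /mapP[x xs ->]; exact: Ds.
- by apply: sub_fin => s [[]].
apply: eq_fsbigr => b; rewrite inE => -[bl Db].
have -> : (words (k @^-1` D) `\ [::]) `&` [set s | size s = l]
          `&` [set s | map k s = b] = [set s | map k s = b].
  apply/seteqP; split=> [s []//|s /= sb].
  rewrite -bl -sb size_map; split=> //; split=> //; split=> [x xs|s0].
    by apply: Db; rewrite -sb map_f.
  by move: l1; rewrite -bl -sb s0.
rewrite scaler_fsum; first by apply: eq_fsbigr => s; rewrite inE /= => ->.
apply: sub_finite_set t_fin => s [/= sb ts]; split=> //= x xs.
by apply: Db; rewrite -sb map_f.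
Qed.

(** * Fractions of a commutative subalgebra *)

Section FractionField.
Variables (F : fieldType) (A : algType F) (X : set A) (B : unitAlgType F).
Variables (j : {lrmorphism A -> B}).
Hypothesis X_alg : subalgebra X.
Hypothesis X_comm : forall x y, X x -> X y -> x * y = y * x.
Hypothesis j_loc : ore_localization (nonzero X) j.

Local Notation K := (fractions X j).

Lemma nonzero1 : nonzero X 1.
Proof. by case: X_alg => X1 _ _; split=> //; apply/eqP; exact: oner_neq0. Qed.

Lemma nonzero_unit s : nonzero X s -> j s \is a GRing.unit.
Proof. by case: j_loc => + _ _; exact. Qed.

(** No zero divisors are excluded beforehand: nonzero elements become units in
    the localization, so their product cannot vanish. *)
Lemma nonzeroM s t : nonzero X s -> nonzero X t -> nonzero X (s * t).
Proof.
move=> Xs Xt; split; first by case: X_alg => _ _; apply; [case: Xs|case: Xt].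
move=> st0; have : j (s * t) \is a GRing.unit.
  by rewrite rmorphM unitrM_comm ?nonzero_unit // /GRing.comm -!rmorphM
    (X_comm Xs.1 Xt.1).
by rewrite st0 rmorph0 unitr0.
Qed.

Lemma fractions_image a : X a -> K (j a).
Proof. by exists 1, a; split=> //; [exact: nonzero1|rewrite rmorph1 invr1 mul1r]. Qed.

Lemma image_comm a b : X a -> X b -> GRing.comm (j a) (j b).
Proof. by move=> Xa Xb; rewrite /GRing.comm -!rmorphM X_comm. Qed.

Lemma image_fractions_comm a x : X a -> K x -> GRing.comm (j a) x.
Proof.
move=> Xa [s [b [Xs Xb ->]]]; apply: commrM; last exact: image_comm.
by apply: commrV; apply: image_comm => //; case: Xs.
Qed.

Lemma fractions_comm x y : K x -> K y -> x * y = y * x.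
Proof.
move=> Kx [s [b [Xs Xb ->]]]; apply: commrM.
  by apply: commrV; apply: commr_sym; apply: image_fractions_comm => //; case: Xs.
by apply: commr_sym; exact: image_fractions_comm.
Qed.

Lemma fractions_subalgebra : subalgebra K.
Proof.
have [X1 XZ XM] := X_alg.
split.
- by rewrite -(rmorph1 j); exact: fractions_image.
- move=> c _ _ [s [a [Xs Xa ->]]] [t [b [Xt Xb ->]]].
  exists (s * t), (c *: (t * a) + s * b); split; first exact: nonzeroM.
    by apply: XZ; apply: XM => //; [case: Xt|case: Xs].
  have st := image_comm Xs.1 Xt.1.
  rewrite rmorphM invrM ?nonzero_unit // linearP /= !rmorphM mulrDr -scalerAr.
  congr (_ *: _ + _).
    rewrite -[_^-1 * _ * _]/((j t)^-1 / j s * (j t * j a)) -invrM ?nonzero_unit //.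
    by rewrite st invrM ?nonzero_unit // -mulrA mulKr ?nonzero_unit.
  by rewrite -mulrA mulKr ?nonzero_unit.
- move=> _ _ [s [a [Xs Xa ->]]] [t [b [Xt Xb ->]]].
  exists (t * s), (a * b); split; [exact: nonzeroM|exact: XM|].
  rewrite !rmorphM invrM ?nonzero_unit // -!mulrA; congr (_ * _).
  rewrite [RHS]mulrA; rewrite [in RHS](_ : (j t)^-1 * j a = j a / j t) ?mulrA //.
  by apply/commr_sym/commrV/image_comm => //; case: Xt.
Qed.

Lemma fractions1 : K 1.
Proof. by case: fractions_subalgebra. Qed.

Lemma fractionsP a x y : K x -> K y -> K (a *: x + y).
Proof. by case: fractions_subalgebra => _ + _; exact. Qed.

Lemma fractionsM x y : K x -> K y -> K (x * y).
Proof. by case: fractions_subalgebra => _ _; exact. Qed.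

Lemma fractionsB x y : K x -> K y -> K (x - y).
Proof. by move=> Kx Ky; rewrite addrC -scaleN1r; exact: fractionsP. Qed.

Lemma fractions_scalar a : K a%:A.
Proof.
rewrite -[a%:A]addr0 -(subrr 1); apply: fractionsP; first exact: fractions1.
by apply: fractionsB; exact: fractions1.
Qed.

Lemma fractions_unit x : K x -> x <> 0 -> x \is a GRing.unit.
Proof.
move=> [s [a [Xs Xa ->]]] sa0; rewrite unitrM_comm.
- rewrite unitrV !nonzero_unit //; split=> // a0.
  by apply: sa0; rewrite a0 rmorph0 mulr0.
- by apply/commr_sym/commrV/image_comm => //; case: Xs.
Qed.

(** The zero fraction is covered too, because its inverse is zero. *)
Lemma fractionsV x : K x -> K x^-1.
Proof.
move=> Kx; have [->|/eqP x0] := eqVneq x 0.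
  by rewrite invr0 -(rmorph0 j); apply: fractions_image; case: X_alg => X1 XZ _;
     rewrite -[0](subrr 1) addrC -scaleN1r; exact: XZ.
case: (Kx) => s [a [Xs Xa xE]]; have Xa0 : nonzero X a.
  by split=> // a0; apply: x0; rewrite xE a0 rmorph0 mulr0.
exists a, s; split=> //; first by case: Xs.
by rewrite xE invrM ?unitrV ?nonzero_unit // invrK.
Qed.

End FractionField.

(** * Generated subalgebras *)

Lemma subalgebra_generated_in (F : fieldType) (A : algType F) (X : set A) x :
  X x -> subalgebra_generated X x.
Proof. exact: sub_gen_smallest. Qed.

Lemma subalgebra_generated_subalgebra (F : fieldType) (A : algType F) (X : set A) :
  subalgebra (subalgebra_generated X).
Proof.
split=> [S [[S1 _ _] _] // | a x y Sx Sy S SS | x y Sx Sy S SS].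
- by have [[_ SZ _] _] := SS; apply: SZ; [exact: Sx|exact: Sy].
- by have [[_ _ SM] _] := SS; apply: SM; [exact: Sx|exact: Sy].
Qed.

Lemma subalgebra_generated_comm (F : fieldType) (A : algType F) (X : set A) :
  (forall x y, X x -> X y -> x * y = y * x) ->
  forall x y, subalgebra_generated X x -> subalgebra_generated X y -> x * y = y * x.
Proof.
move=> X_comm.
have centr (Y : set A) : subalgebra [set x | forall y, Y y -> GRing.comm x y].
  split=> [y _|a x z Cx Cz y Yy|x z Cx Cz y Yy]; first exact/commr_sym/commr1.
  - rewrite /GRing.comm mulrDl mulrDr -scalerAl -scalerAr Cx //; congr (_ + _).
    exact: Cz.
  - by apply/commr_sym/commrM; apply/commr_sym; [exact: Cx|exact: Cz].
move=> x y Sx Sy.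
apply: (Sx [set x | forall y, subalgebra_generated X y -> GRing.comm x y]) => //.
split=> // z Xz w Sw; apply: commr_sym.
apply: (Sw [set y | forall x, X x -> GRing.comm y x]) => //.
by split=> // v Xv v' Xv'; exact: X_comm.
Qed.

(** * Weights *)

Lemma linear_weight0 (F : fieldType) (h : lmodType F) :
  linear_weight (0 : h -> F).
Proof. by move=> a x y; rewrite /= mulr0 addr0. Qed.

Lemma linear_weightN (F : fieldType) (h : lmodType F) (l : h -> F) :
  linear_weight l -> linear_weight (- l).
Proof. by move=> l_lin a x y; rewrite !fctE l_lin opprD mulrN. Qed.

Lemma linear_weightD (F : fieldType) (h : lmodType F) (l m : h -> F) :
  linear_weight l -> linear_weight m -> linear_weight (l + m).
Proof. by move=> l_lin m_lin a x y; rewrite !fctE l_lin m_lin mulrDr addrACA. Qed.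

Lemma wsum_cons (F : fieldType) (h : lmodType F) (l : h -> F) b :
  wsum (l :: b) = l + wsum b.
Proof. exact: big_cons. Qed.

Lemma wsum_cat (F : fieldType) (h : lmodType F) (b c : seq (h -> F)) :
  wsum (b ++ c) = wsum b + wsum c.
Proof. exact: big_cat. Qed.

Lemma wsum_linear (F : fieldType) (h : lmodType F) (D : set (h -> F)) b :
  (forall l, D l -> linear_weight l) -> (forall l, l \in b -> D l) ->
  linear_weight (wsum b).
Proof.
move=> D_lin; elim: b => [_|l b IH Db].
  by rewrite /wsum big_nil; exact: linear_weight0.
rewrite wsum_cons; apply: linear_weightD.
  by apply/D_lin/Db; rewrite inE eqxx.
by apply: IH => m mb; apply: Db; rewrite inE mb orbT.
Qed.

Lemma cone_wsum (F : fieldType) (h : lmodType F) (X : set (h -> F)) b :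
  (forall l, l \in b -> cone X l) -> cone X (wsum b).
Proof.
elim: b => [_|l b IH Xb]; first by exists [::].
have [c [Xc lc]] := Xb l (mem_head _ _).
have [c' [Xc' bc]] : cone X (wsum b).
  by apply: IH => m mb; apply: Xb; rewrite inE mb orbT.
exists (c ++ c'); rewrite wsum_cons wsum_cat -lc -bc; split=> // m.
by rewrite mem_cat => /orP[/Xc|/Xc'].
Qed.

(** * The shifts of U'(h) *)

Section Intertwine.
Variables (F : fieldType) (A : algType F) (h : lmodType F) (ih : h -> A).
Variables (B : unitAlgType F) (j : {lrmorphism A -> B}).
Hypothesis ih_comm : forall x y, ih x * ih y = ih y * ih x.

Local Notation X := (subalgebra_generated (range ih)).
Local Notation K := (fractions X j).
Hypothesis j_loc : ore_localization (nonzero X) j.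

Variable sh : (h -> F) -> B -> B.
Hypothesis sh_spec : weight_shifts K (j \o ih) sh.

Let X_alg : subalgebra X := subalgebra_generated_subalgebra _.
Let X_comm x y : X x -> X y -> x * y = y * x.
Proof.
by apply: subalgebra_generated_comm => _ _ [a _ <-] [b _ <-]; exact: ih_comm.
Qed.

Let K1 := fractions1 X_alg X_comm j_loc.
Let KV := fractionsV X_alg j_loc.
Let Kimage := fractions_image j X_alg.
Let Kih y : K (j (ih y)).
Proof. by apply: Kimage; apply: subalgebra_generated_in; exists y. Qed.

Section OneShift.
Variable l : h -> F.
Hypothesis l_lin : linear_weight l.

Lemma shift_closed x : K x -> K (sh l x).
Proof. by case: (sh_spec l_lin) => -[[Kl _ _] _ _ _] _; exact: Kl. Qed.

Lemma shift1 : sh l 1 = 1.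
Proof. by case: (sh_spec l_lin) => -[]. Qed.

Lemma shiftP a x y : K x -> K y -> sh l (a *: x + y) = a *: sh l x + sh l y.
Proof. by case: (sh_spec l_lin) => -[_ _ + _] _; exact. Qed.

Lemma shiftM x y : K x -> K y -> sh l (x * y) = sh l x * sh l y.
Proof. by case: (sh_spec l_lin) => -[_ _ _ +] _; exact. Qed.

Lemma shift_cartan y : sh l (j (ih y)) = j (ih y) + (l y)%:A.
Proof. by case: (sh_spec l_lin) => _; exact. Qed.

Lemma shiftV x : K x -> x \is a GRing.unit ->
  sh l x \is a GRing.unit /\ sh l x^-1 = (sh l x)^-1.
Proof.
move=> Kx xu; have e : sh l x^-1 * sh l x = 1.
  by rewrite -shiftM ?mulVr ?shift1 //; last exact: KV.
have e' : sh l x * sh l x^-1 = 1.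
  by rewrite -shiftM ?mulrV ?shift1 //; last exact: KV.
have u : sh l x \is a GRing.unit by apply/unitrP; exists (sh l x^-1).
by split=> //; apply: (mulrI u); rewrite e' mulrV.
Qed.

(** The rule q (u h) = h^l q u for h in the Cartan subalgebra propagates to
    products, and to inverses because the kernel of q is stable under right
    multiplication by fractions.  The case where q is the identity moves
    fractions across weight vectors of U'(g), and the case of the projection
    onto M describes the right action on a weight space of M. *)
Lemma weight_vector_shift (N : lmodType B) (q : {linear B^o -> N}) (u : B) :
  (forall (v phi : B), K phi -> q v = 0 -> q (v * phi) = 0) ->
  (forall y, q (u * j (ih y)) = (j (ih y) + (l y)%:A) *: q u) ->
  forall phi, K phi -> q (u * phi) = sh l phi *: q u.
Proof.
move=> q_stable qu.
have qM (b v : B) : q (b * v) = b *: q v by exact: (linearZZ q b v).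
have q_ext (v w : B) phi : K phi -> q v = q w -> q (v * phi) = q (w * phi).
  move=> Kphi vw; apply/eqP; rewrite -subr_eq0 -linearB /= -mulrBl.
  by apply/eqP; apply: q_stable => //; rewrite linearB /= vw subrr.
have qX a : X a -> q (u * j a) = sh l (j a) *: q u.
  pose S := [set a | X a /\ q (u * j a) = sh l (j a) *: q u].
  suff XS : subalgebra S.
    move=> Xa; suff [] : S a by [].
    apply: Xa; split=> // _ [y _ <-]; split.
      by apply: subalgebra_generated_in; exists y.
    by rewrite qu shift_cartan.
  have [X1 XZ XM] := X_alg; split.
  - by split=> //; rewrite rmorph1 mulr1 shift1 scale1r.
  - move=> c x y [Xx qx] [Xy qy]; split; first exact: XZ.
    rewrite linearP /= shiftP; [|exact: Kimage..].
    rewrite mulrDr -scalerAr -[_ *: (u * _)]mulr_algl.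
    by rewrite linearD /= (qM c%:A) qx qy scalerDl scalerA mulr_algl.
  - move=> x y [Xx qx] [Xy qy]; split; first exact: XM.
    rewrite rmorphM shiftM; [|exact: Kimage..].
    rewrite mulrA (q_ext _ (sh l (j x) * u)) ?(qM (sh l (j x))) //.
    + by rewrite -mulrA (qM (sh l (j x))) qy scalerA.
    + exact: Kimage.
move=> phi [s [a [Xs Xa ->]]].
have Ks := Kimage Xs.1; have Ka := Kimage Xa.
have su := nonzero_unit j_loc Xs.
have [shu shVE] := shiftV Ks su.
rewrite shiftM ?shVE //; last exact: KV.
rewrite mulrA (q_ext _ ((sh l (j s))^-1 * u)) //.
  by rewrite -mulrA (qM (sh l (j s))^-1) qX // scalerA.
rewrite -[u in RHS](mulrK su) mulrA; apply: q_ext; first exact: KV.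
by rewrite (qM (sh l (j s))^-1) qX ?scalerA ?mulVr ?scale1r //; case: Xs.
Qed.

(** The Cartan elements generate the fractions, so their images determine a
    multiplicative linear map. *)
Lemma shift_unique (T : B -> B) :
  T 1 = 1 -> (forall a x y, K x -> K y -> T (a *: x + y) = a *: T x + T y) ->
  (forall x y, K x -> K y -> T (x * y) = T x * T y) ->
  (forall y, T (j (ih y)) = j (ih y) + (l y)%:A) ->
  forall phi, K phi -> T phi = sh l phi.
Proof.
move=> T1 TZ TM Tih.
have TX a : X a -> T (j a) = sh l (j a).
  pose S := [set a | X a /\ T (j a) = sh l (j a)].
  suff XS : subalgebra S.
    move=> Xa; suff [] : S a by [].
    apply: Xa; split=> // _ [y _ <-]; split.
      by apply: subalgebra_generated_in; exists y.
    by rewrite Tih shift_cartan.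
  have [X1 XZ XM] := X_alg; split.
  - by split=> //; rewrite rmorph1 T1 shift1.
  - move=> c x y [Xx Tx] [Xy Ty]; split; first exact: XZ.
    by rewrite linearP /= shiftP ?TZ ?Tx ?Ty //; exact: Kimage.
  - move=> x y [Xx Tx] [Xy Ty]; split; first exact: XM.
    by rewrite rmorphM shiftM ?TM ?Tx ?Ty //; exact: Kimage.
move=> phi [s [a [Xs Xa ->]]].
have Ks := Kimage Xs.1; have Ka := Kimage Xa.
have su := nonzero_unit j_loc Xs.
have [shu shVE] := shiftV Ks su.
have KsV := KV Ks.
rewrite shiftM ?TM // TX // shVE; congr (_ * _); apply: (mulIr shu).
by rewrite mulVr // -(TX _ Xs.1) -TM // mulVr.
Qed.

End OneShift.

Lemma shift0 phi : K phi -> sh 0 phi = phi.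
Proof.
move=> Kphi; apply/esym.
apply: (shift_unique (@linear_weight0 F h) (T := @id B)) => // y.
by rewrite scale0r addr0.
Qed.

Lemma shiftD l m phi : linear_weight l -> linear_weight m -> K phi ->
  sh l (sh m phi) = sh (l + m) phi.
Proof.
move=> l_lin m_lin.
apply: (shift_unique (linear_weightD l_lin m_lin) (T := sh l \o sh m)) => /=.
- by rewrite !shift1.
- by move=> a x y Kx Ky; rewrite shiftP // shiftP //; exact: shift_closed.
- by move=> x y Kx Ky; rewrite shiftM // shiftM //; exact: shift_closed.
- move=> y; rewrite shift_cartan // addrC shiftP //.
  rewrite shift1 // shift_cartan //.
  by rewrite addrCA -scalerDl [m y + l y]addrC.
Qed.

End Intertwine.

(** * The localized universal Verma module *)

Section Verma.
Variables (F : fieldType) (g : lmodType F) (par : bool -> set g) (br : g -> g -> g).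
Variables (gm gp : set g) (h : lmodType F) (inh : {linear h -> g}).
Hypothesis g_dec : direct_sum3 gm (range inh) gp.
Hypothesis h_even : range inh `<=` par false.
Hypothesis h_abel : abelian_set br (range inh).
Variables (D : set (h -> F)) (D_lin : forall b, D b -> linear_weight b).
Variables (I : (h -> F) -> choiceType) (e f : rootindex I -> g).
Local Notation DI := [set x : rootindex I | D (tag x)].
Hypothesis e_basis : is_basis DI e gp.
Hypothesis f_basis : is_basis DI f gm.
Hypothesis e_hom : forall x, D (tag x) -> exists b, par b (e x).
Hypothesis f_hom : forall x, D (tag x) -> exists b, par b (f x).
Hypothesis e_weight : forall x (y : h), D (tag x) -> br (inh y) (e x) = tag x y *: e x.
Hypothesis f_weight : forall x (y : h), D (tag x) ->
  br (inh y) (f x) = - (tag x y *: f x).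
Variables (U : algType F) (i : {linear g -> U}).
Hypothesis U_env : enveloping_algebra par br i.
Local Notation Uh := (subalgebra_generated (range (i \o inh))).
Variables (U' : unitAlgType F) (j : {lrmorphism U -> U'}).
Hypothesis U'_loc : ore_localization (nonzero Uh) j.
Variable sh : (h -> F) -> U' -> U'.
Hypothesis sh_spec : weight_shifts (fractions Uh j) (j \o i \o inh) sh.
Variables (M : lmodType U') (p : {linear U'^o -> M}).
Hypothesis M_quot : quotient_map (left_ideal_generated ((j \o i) @` gp)) p.

Local Notation K := (fractions Uh j).
Local Notation ei x := (j (i (e x))).
Local Notation fi x := (j (i (f x))).
Local Notation hi y := (j (i (inh y))).

Let pM (a u : U') : p (a * u) = a *: p u. Proof. exact: (linearZZ p). Qed.

Let inh_even y : par false (inh y). Proof. by apply: h_even; exists y. Qed.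

Lemma cartan_comm x y : (i \o inh) x * (i \o inh) y = (i \o inh) y * (i \o inh) x.
Proof.
case: U_env => i_rep _.
have := i_rep false false (inh x) (inh y) (inh_even _) (inh_even _).
rewrite h_abel; [|by exists x|by exists y].
by rewrite linear0 /= expr0 mul1r => /esym/eqP; rewrite subr_eq0 => /eqP.
Qed.

Let Uh_alg : subalgebra Uh := subalgebra_generated_subalgebra _.
Let Uh_comm a b : Uh a -> Uh b -> a * b = b * a.
Proof.
by apply: subalgebra_generated_comm => _ _ [x _ <-] [y _ <-]; exact: cartan_comm.
Qed.
Let K1 := fractions1 Uh_alg Uh_comm U'_loc.
Let KP := fractionsP Uh_alg Uh_comm U'_loc.
Let KM := fractionsM Uh_alg Uh_comm U'_loc.
Let KB := fractionsB Uh_alg Uh_comm U'_loc.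
Let Kscal := fractions_scalar Uh_alg Uh_comm U'_loc.
Let KV := fractionsV Uh_alg U'_loc.
Let Kcomm := fractions_comm (j := j) Uh_comm.
Let Kunit := fractions_unit Uh_comm U'_loc.
Let Kimage a : Uh a -> K (j a).
Proof. exact: fractions_image. Qed.
Let Kih y : K (hi y).
Proof. by apply: Kimage; apply: subalgebra_generated_in; exists y. Qed.
Let shift_closed := shift_closed sh_spec.
Let shiftD := shiftD cartan_comm U'_loc sh_spec.
Let shift0 := shift0 U'_loc sh_spec.

Lemma cartan_e x y : D (tag x) -> ei x * hi y = (hi y - (tag x y)%:A) * ei x.
Proof.
move=> Dx; have [b eb] := e_hom Dx; case: U_env => i_rep _.
have := i_rep false b (inh y) (e x) (inh_even _) eb.
rewrite e_weight // linearZ /= expr0 mul1r => E.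
rewrite mulrBl mulr_algl -linearZ /= E linearB !rmorphM /=.
by rewrite opprB addrC subrK.
Qed.

Lemma cartan_f x y : D (tag x) -> fi x * hi y = (hi y + (tag x y)%:A) * fi x.
Proof.
move=> Dx; have [b fb] := f_hom Dx; case: U_env => i_rep _.
have := i_rep false b (inh y) (f x) (inh_even _) fb.
rewrite f_weight // linearN linearZ /= expr0 mul1r => E.
rewrite mulrDl mulr_algl -linearZ /= -[_ *: _]opprK E opprB linearB !rmorphM /=.
by rewrite addrC subrK.
Qed.

Lemma element_shift (l : h -> F) (u : U') : linear_weight l ->
  (forall y, u * hi y = (hi y + (l y)%:A) * u) ->
  forall phi, K phi -> u * phi = sh l phi * u.
Proof.
move=> l_lin uE.
apply: (weight_vector_shift U'_loc sh_spec l_lin (q := idfun : {linear U'^o -> U'^o})).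
  by move=> v phi _ /= ->; rewrite mul0r.
exact: uE.
Qed.

Lemma e_shift x phi : D (tag x) -> K phi -> ei x * phi = sh (- tag x) phi * ei x.
Proof.
move=> Dx; apply: element_shift; first exact/linear_weightN/D_lin.
by move=> y; rewrite cartan_e // scaleNr.
Qed.

Lemma f_shift x phi : D (tag x) -> K phi -> fi x * phi = sh (tag x) phi * fi x.
Proof.
by move=> Dx; apply: element_shift; [exact: D_lin|move=> y; exact: cartan_f].
Qed.

Lemma verma_e0 v x : D (tag x) -> p (v * ei x) = 0.
Proof.
move=> Dx; apply/M_quot.2 => S [[S0 SD SM] gpS]; apply: SM; apply: gpS.
by exists (e x) => //; case: e_basis => _ + _ _; exact.
Qed.

(** A fraction moves to the left of a weight vector of g_+ at the cost of a
    shift, so the left ideal generated by g_+ is stable on the right as well.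
    Hence the right action of U'(h) on M is well defined. *)
Lemma verma_ker_stable v phi : K phi -> p v = 0 -> p (v * phi) = 0.
Proof.
move=> Kphi /(M_quot.2 v).1 Nv.
apply: (Nv [set v | forall psi, K psi -> p (v * psi) = 0]) => //; split.
  split=> [psi _|v1 v2 v1P v2P psi Kp|r v1 v1P psi Kp].
  - by rewrite mul0r linear0.
  - by rewrite mulrDl linearD /= v1P // v2P // addr0.
  - by rewrite -mulrA pM v1P // scaler0.
move=> _ [z gz <-] psi Kpsi /=; case: e_basis => _ _ /(_ z gz)[s [c [sD ->]]] _.
rewrite !linear_sum /= mulr_suml linear_sum big_seq /= big1 // => x /sD Dx.
rewrite !linearZ /= -mulr_algl -scalerA -pM e_shift //.
by rewrite verma_e0 // scaler0.
Qed.

Lemma verma_ext u v phi : K phi -> p u = p v -> p (u * phi) = p (v * phi).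
Proof.
move=> Kphi uv; apply/eqP; rewrite -subr_eq0 -linearB /= -mulrBl.
by apply/eqP; apply: verma_ker_stable => //; rewrite linearB /= uv subrr.
Qed.

(** A representative in U'(g) of a vector of M of weight [- l]: the adjoint
    action is replaced by the equivalent rule that h on the right acts as
    h + l(h) on the left. *)
Definition weight_rep (l : h -> F) (u : U') :=
  forall y, p (u * hi y) = (hi y + (l y)%:A) *: p u.

Lemma weight_rep_weight_space l u : weight_rep l u ->
  weight_space (j \o i \o inh) p (- l) (p u).
Proof.
move=> lu v vu y /=; rewrite (verma_ext (Kih y) vu) lu scalerDl opprD addrA subrr.
by rewrite add0r -scaleNr -scaleNr.
Qed.

Lemma weight_rep_shift l u phi : linear_weight l -> weight_rep l u -> K phi ->
  p (u * phi) = sh l phi *: p u.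
Proof.
move=> l_lin lu; apply: (weight_vector_shift U'_loc sh_spec l_lin) => //.
by move=> v psi Kpsi; exact: verma_ker_stable.
Qed.

Lemma weight_rep1 : weight_rep 0 1.
Proof. by move=> y; rewrite mul1r scale0r addr0 -pM mulr1. Qed.

Lemma weight_rep_fraction l u phi : K phi -> weight_rep l u -> weight_rep l (phi * u).
Proof.
move=> Kphi lu y; rewrite -mulrA pM lu pM !scalerA; congr (_ *: _).
by rewrite Kcomm // addrC; apply: KP; [exact: K1|exact: Kih].
Qed.

Lemma weight_rep_e l u x : D (tag x) -> weight_rep l u ->
  weight_rep (l - tag x) (ei x * u).
Proof.
move=> Dx lu y; rewrite -mulrA pM lu pM !scalerA; congr (_ *: _).
rewrite mulrDr cartan_e // -scalerAr mulr1 -[l y *: ei x]mulr_algl -mulrDl.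
by rewrite !fctE scalerBl addrAC addrA.
Qed.

Lemma weight_rep_f l u x : D (tag x) -> weight_rep l u ->
  weight_rep (l + tag x) (fi x * u).
Proof.
move=> Dx lu y; rewrite -mulrA pM lu pM !scalerA; congr (_ *: _).
rewrite mulrDr cartan_f // -scalerAr mulr1 -[l y *: fi x]mulr_algl -mulrDl.
by rewrite !fctE scalerDl [(l y)%:A + _]addrC addrA.
Qed.

Local Notation fword s := (\prod_(x <- s) fi x).
Local Notation eword s := (\prod_(x <- rev s) ei x).

Lemma words_weights s : words DI s -> forall l, l \in weights_of s -> D l.
Proof. by move=> Ds _ /mapP[x xs ->]; exact: Ds. Qed.

Lemma words_linear s : words DI s -> linear_weight (wsum (weights_of s)).
Proof. by move=> Ds; apply: (wsum_linear D_lin); exact: words_weights. Qed.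

Lemma weight_rep_fword s l u : words DI s -> weight_rep l u ->
  weight_rep (l + wsum (weights_of s)) (fword s * u).
Proof.
elim: s => [_ lu|x s IH /words_cons[Dx Ds] lu].
  by rewrite /wsum !big_nil addr0 mul1r.
rewrite big_cons -mulrA wsum_cons [tag x + _]addrC addrA.
by apply: weight_rep_f => //; exact: IH.
Qed.

Lemma weight_rep_eword s l u : words DI s -> weight_rep l u ->
  weight_rep (l - wsum (weights_of s)) (eword s * u).
Proof.
elim/last_ind: s => [_ lu|s x IH /words_rcons[Ds Dx] lu].
  by rewrite /wsum !big_nil subr0 mul1r.
rewrite rev_rcons big_cons -mulrA /weights_of map_rcons -cats1 wsum_cat.
rewrite /wsum big_seq1 opprD addrA; apply: weight_rep_e => //; exact: IH.
Qed.

Lemma fword_shift s phi : words DI s -> K phi ->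
  fword s * phi = sh (wsum (weights_of s)) phi * fword s.
Proof.
elim: s => [_ Kphi|x s IH /words_cons[Dx Ds] Kphi].
  by rewrite /wsum !big_nil mulr1 mul1r shift0.
rewrite !big_cons -mulrA IH // mulrA f_shift //; last first.
  by apply: shift_closed => //; exact: words_linear.
rewrite mulrA wsum_cons -shiftD //; first exact: D_lin.
exact: words_linear.
Qed.

(** Terms of the Casimir operator have weight 0. *)
Lemma fe_shift x phi : D (tag x) -> K phi -> (fi x * ei x) * phi = phi * (fi x * ei x).
Proof.
move=> Dx Kphi; have Nx := linear_weightN (D_lin Dx).
rewrite -mulrA e_shift // mulrA f_shift //; last exact: shift_closed.
by rewrite shiftD ?subrr ?shift0 ?mulrA //; exact: D_lin.
Qed.

(** * Weight decomposition *)

Definition additive_span (X : set M) : set M :=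
  smallest [set S : set M | S 0 /\ forall m n, S m -> S n -> S (m + n)] X.

(** Eventually all of M ([fword_span_all]).  As a smallest additive set it
    comes with induction on sums of weight vectors. *)
Definition fword_span : set M :=
  additive_span [set m | exists s phi,
     [/\ words DI s, K phi & m = p (fword s * phi)]].

Lemma fword_span0 : fword_span 0.
Proof. by move=> S [[S0 _] _]. Qed.

Lemma fword_spanD m n : fword_span m -> fword_span n -> fword_span (m + n).
Proof. by move=> Lm Ln S SS; apply: SS.1.2; [exact: Lm|exact: Ln]. Qed.

Lemma fword_span_word s phi : words DI s -> K phi -> fword_span (p (fword s * phi)).
Proof. by move=> Ds Kphi S [_]; apply; exists s, phi. Qed.

Lemma fword_span_stable (a : U') :
  (forall s phi, words DI s -> K phi -> fword_span (a *: p (fword s * phi))) ->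
  forall m, fword_span m -> fword_span (a *: m).
Proof.
move=> aP m Lm; apply: (Lm [set m | fword_span (a *: m)]); split.
  split; first by rewrite /= scaler0; exact: fword_span0.
  by move=> n1 n2 L1 L2; rewrite /= scalerDr; apply: fword_spanD.
by move=> _ [s [phi [Ds Kphi ->]]]; exact: aP.
Qed.

Lemma fword_span_f x m : D (tag x) -> fword_span m -> fword_span (fi x *: m).
Proof.
move=> Dx; apply: fword_span_stable => s phi Ds Kphi.
rewrite -pM mulrA -(big_cons _ _ x s xpredT) /=; apply: fword_span_word => //.
exact/words_cons.
Qed.

Lemma fword_span_fraction phi m : K phi -> fword_span m -> fword_span (phi *: m).
Proof.
move=> Kphi; apply: fword_span_stable => s chi Ds Kchi.
rewrite -pM mulrA.
have s_lin := words_linear Ds; have Ns_lin := linear_weightN s_lin.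
have Kphi' : K (sh (- wsum (weights_of s)) phi) by exact: shift_closed.
rewrite -[phi](_ : sh (wsum (weights_of s)) (sh (- wsum (weights_of s)) phi) = _).
  rewrite -fword_shift // -mulrA; apply: fword_span_word => //; exact: KM.
by rewrite shiftD // subrr shift0.
Qed.

Lemma fword_span_scale (c : F) m : fword_span m -> fword_span (c%:A *: m).
Proof. by move=> Lm; apply: fword_span_fraction => //; exact: Kscal. Qed.

Lemma fword_span_sum (T : eqType) (r : seq T) (G : T -> M) :
  (forall x, x \in r -> fword_span (G x)) -> fword_span (\sum_(x <- r) G x).
Proof.
by move=> rG; rewrite big_seq; apply: (big_ind fword_span fword_span0 fword_spanD).
Qed.

Lemma fword_span_basis (T : choiceType) (X : set T) (b : T -> g) (W : set g) m :
  is_basis X b W -> (forall x, X x -> fword_span (j (i (b x)) *: m)) ->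
  forall a, W a -> fword_span (j (i a) *: m).
Proof.
move=> [_ _ gen _] bL a /gen[s [c [sX ->]]].
rewrite !linear_sum /= scaler_suml; apply: fword_span_sum => x /sX Xx.
by rewrite !linearZ /= -mulr_algl -scalerA; apply: fword_span_scale; exact: bL.
Qed.

(** The sign of the supercommutator is absorbed in the scalar c, so that the
    arguments about spans do not distinguish parities. *)
Lemma e_f_exchange x y : D (tag x) -> D (tag y) ->
  exists c : F, ei x * fi y = j (i (br (e x) (f y))) + c *: (fi y * ei x).
Proof.
move=> Dx Dy; have [b xb] := e_hom Dx; have [b' yb'] := f_hom Dy.
exists ((-1) ^+ (b && b')); case: U_env => i_rep _.
rewrite (i_rep b b') // rmorphB !rmorphM /= rmorphXn rmorphN1.
case: (b && b'); first by rewrite expr1 mulN1r opprK scaleN1r addrK.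
by rewrite expr0 mul1r scale1r subrK.
Qed.

(** Induction on the word of f's.  Elements of g_- lengthen the word and
    Cartan elements act by a fraction.  An e is moved past the first f: the
    supercommutator is again an element of g in front of a shorter word, and
    at the empty word e kills the generator of M. *)
Lemma fword_span_g a m : fword_span m -> fword_span (j (i a) *: m).
Proof.
apply: fword_span_stable => s; elim: s a => [|y s IH] a phi Ds Kphi;
  have [[[am a0] ap] [[/= gam ra0 gap ->] _]] := g_dec a;
  rewrite !linearD /= !scalerDl; apply: fword_spanD; try apply: fword_spanD.
- apply: (fword_span_basis f_basis) gam => x Dx; apply: fword_span_f => //.
  exact: fword_span_word.
- case: ra0 => y _ <-; apply: fword_span_fraction; first exact: Kih.
  exact: fword_span_word.
- apply: (fword_span_basis e_basis) gap => x Dx.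
  rewrite big_nil mul1r -pM e_shift // verma_e0 //; exact: fword_span0.
- apply: (fword_span_basis f_basis) gam => x Dx; apply: fword_span_f => //.
  exact: fword_span_word.
- case: ra0 => z _ <-; apply: fword_span_fraction; first exact: Kih.
  exact: fword_span_word.
- apply: (fword_span_basis e_basis) gap => x Dx.
  have [Dy Ds'] := (words_cons _ y s).1 Ds.
  have [c cE] := e_f_exchange Dx Dy.
  rewrite -pM big_cons !mulrA cE !mulrDl linearD /=; apply: fword_spanD.
    by rewrite -mulrA pM; exact: IH.
  rewrite -mulr_algl -!mulrA (pM c%:A) (pM (fi y)) (pM (ei x)).
  apply: fword_span_scale; apply: fword_span_f => //.
  exact: IH.
Qed.

(** The elements of U(g) that preserve the span form a subalgebra containing
    g, so the span is stable under U(g) and under inverses of fractions. *)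
Lemma fword_span_all m : fword_span m.
Proof.
have [x <-] := M_quot.1 m; case: U'_loc => _ /(_ x)[s [a [Xs ->]]] _.
rewrite pM; apply: fword_span_fraction; first by apply/KV/Kimage; case: Xs.
rewrite -[j a]mulr1 pM.
apply: (enveloping_algebra_ind
  (S := [set a | forall m, fword_span m -> fword_span (j a *: m)]) U_env _ _ a) => [| |]; last first.
- by have := @fword_span_word [::] 1 _ K1; rewrite big_nil mulr1; apply.
- by move=> b n Ln; exact: fword_span_g.
split.
- by move=> n Ln; rewrite rmorph1 scale1r.
- move=> c x1 x2 L1 L2 n Ln; rewrite linearP /= scalerDl -mulr_algl -scalerA.
  by apply: fword_spanD; [apply: fword_span_scale; exact: L1|exact: L2].
- by move=> x1 x2 L1 L2 n Ln; rewrite rmorphM -scalerA; apply: L1; exact: L2.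
Qed.

Lemma weight_rep_scale l u (c : F) : weight_rep l u -> weight_rep l (c%:A * u).
Proof. by apply: weight_rep_fraction; exact: Kscal. Qed.

(** Vectors of distinct weights are independent.  With y separating l from the
    weight of the first term, the operator ad y minus the eigenvalue of that
    term on y kills the term, rescales the others, and multiplies p u by a
    nonzero scalar. *)
Lemma weight_rep_independent (L : seq ((h -> F) * U')) l u : weight_rep l u ->
  (forall z, z \in L -> weight_rep z.1 z.2 /\ (z.1 <> l \/ p z.2 = 0)) ->
  p u = \sum_(z <- L) p z.2 -> p u = 0.
Proof.
have [n] := ubnP (size L); elim: n L u => // n IH [|z L] u /= Ln lu Lz.
  by rewrite big_nil.
have LzL w : w \in L -> weight_rep w.1 w.2 /\ (w.1 <> l \/ p w.2 = 0).
  by move=> wL; apply: Lz; rewrite inE wL orbT.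
have [lz [zl|pz0]] := Lz z (mem_head _ _); last first.
  by rewrite big_cons pz0 add0r; apply: IH.
move=> puE.
have [y /eqP lzy] : exists y, l y <> z.1 y.
  apply: contrapT => /forallNP lz0; apply: zl; apply/funext => y.
  by apply/esym; apply: contrapT; exact: (lz0 y).
suff : p ((l y - z.1 y)%:A * u) = 0.
  rewrite pM => /(congr1 ( *:%R ((l y - z.1 y)^-1)%:A)).
  rewrite scaler0 scalerA mulr_algl scalerA mulVf ?subr_eq0 //.
  by rewrite scale1r scale1r.
have actE : (l y)%:A *: p u = \sum_(w <- z :: L) (w.1 y)%:A *: p w.2.
  have sumE : p u = p (\sum_(w <- z :: L) w.2) by rewrite linear_sum.
  have := verma_ext (Kih y) sumE; rewrite lu mulr_suml linear_sum /= scalerDl puE.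
  have -> : \sum_(w <- z :: L) p (w.2 * hi y) =
      \sum_(w <- z :: L) (hi y *: p w.2 + (w.1 y)%:A *: p w.2).
    rewrite big_seq [RHS]big_seq; apply: eq_bigr => w wL.
    by rewrite (Lz w wL).1 scalerDl.
  by rewrite big_split /= -scaler_sumr => /addrI.
pose scaled w : (h -> F) * U' := (w.1, (w.1 y - z.1 y)%:A * w.2).
apply: (IH (map scaled L)) => [||_ /mapP[w wL ->] /=|].
- by rewrite size_map.
- exact: weight_rep_scale.
- have [lw b] := LzL w wL; split; first exact: weight_rep_scale.
  by case: b => [|pw0]; [left|right; rewrite pM pw0 scaler0].
rewrite big_map pM scalerBl [LHS]scalerBl actE puE scaler_sumr -sumrB.
rewrite big_cons subrr add0r; apply: eq_bigr => w _.
by rewrite pM scalerBl [RHS]scalerBl.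
Qed.

(** A weight space without a nonzero word of f's of that weight is zero, by
    independence of weights. *)
Lemma weight_rep_support l u : weight_rep l u -> p u <> 0 ->
  exists s, [/\ words DI s, wsum (weights_of s) = l & fword s <> 0].
Proof.
move=> lu pu0; apply: contrapT => /forallNP noword; apply: pu0.
pose good (z : (h -> F) * U') := weight_rep z.1 z.2 /\ (z.1 <> l \/ p z.2 = 0).
suff [L [Lgood puL]] : exists L : seq ((h -> F) * U'),
    (forall z, z \in L -> good z) /\ p u = \sum_(z <- L) p z.2.
  exact: weight_rep_independent puL.
have Lpu := @fword_span_all (p u).
apply: (Lpu [set m | exists L : seq ((h -> F) * U'),
    (forall z, z \in L -> good z) /\ m = \sum_(z <- L) p z.2]); split.
  split; first by exists [::]; split=> //; rewrite big_nil.
  move=> _ _ [L1 [L1P ->]] [L2 [L2P ->]]; exists (L1 ++ L2); rewrite big_cat.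
  by split=> // z; rewrite mem_cat => /orP[/L1P|/L2P].
move=> _ [s [phi [Ds Kphi ->]]].
exists [:: (wsum (weights_of s), fword s * phi)]; rewrite big_seq1; split=> // z.
rewrite inE => /eqP->; split=> /=.
  rewrite -[wsum _]add0r; apply: weight_rep_fword => //.
  by rewrite -[phi]mulr1; apply: weight_rep_fraction => //; exact: weight_rep1.
have [fs0|fs0] := pselect (fword s = 0).
  by right; rewrite fs0 mul0r linear0.
by left=> sl; apply: (noword s).
Qed.

(** * The Casimir operator on M *)

Section Casimir.
Variables (V : lmodType U) (pV : {linear U^o -> V}).
Hypothesis V_quot : quotient_map (left_ideal_generated (i @` gp)) pV.
Variable Omega0 : U.
Hypothesis Omega0_h : Uh Omega0.
Hypothesis Omega_fin : forall v : V,
  finite_set [set x | D (tag x) /\ (i (f x) * i (e x)) *: v <> 0].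
Hypothesis Omega_comm : forall (u : U) (v : V),
  casimir D (i \o e) (i \o f) Omega0 (u *: v) =
  u *: casimir D (i \o e) (i \o f) Omega0 v.
Hypothesis Omega0_comm : forall u : U, u * Omega0 = Omega0 * u ->
  forall y : h, u * i (inh y) = i (inh y) * u.

Let pVM (a u : U) : pV (a * u) = a *: pV u. Proof. exact: (linearZZ pV). Qed.

(** If Omega_0 were invariant under the shift by l, a nonzero word a of f's of
    weight l would commute with Omega_0 in U'(g).  In U(g) this holds only up
    to a left factor sigma from U(h), so it is sigma a that commutes with
    Omega_0, hence with the Cartan subalgebra.  But [h, a] = - l(h) a, so
    l = 0. *)
Lemma shift_Omega0_neq l u : linear_weight l -> weight_rep l u -> p u <> 0 ->
  l <> 0 -> sh l (j Omega0) - j Omega0 <> 0.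
Proof.
move=> l_lin lu pu0 l0 /subr0_eq shO; apply: l0.
have [s [Ds sl fs0]] := weight_rep_support lu pu0.
have [a ja] : exists a, j a = fword s.
  by exists (\prod_(x <- s) i (f x)); rewrite rmorph_prod.
have [_ _ jker] := U'_loc.
have [sigma [Xsigma sigma0] sa] :
    exists2 sigma, nonzero Uh sigma & sigma * (a * Omega0 - Omega0 * a) = 0.
  apply/jker; rewrite rmorphB !rmorphM /= ja fword_shift ?sl ?shO ?subrr //.
  exact: Kimage.
have sO : sigma * Omega0 = Omega0 * sigma.
  exact: Uh_comm.
have comm : (sigma * a) * Omega0 = Omega0 * (sigma * a).
  by rewrite mulrA -sO -!mulrA; apply/subr0_eq; rewrite -mulrBr.
apply/funext => y; have := congr1 j (Omega0_comm comm y).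
have su : j sigma \is a GRing.unit by exact: (nonzero_unit U'_loc (conj Xsigma sigma0)).
have sy : sigma * i (inh y) = i (inh y) * sigma.
  by apply: Uh_comm => //; apply: subalgebra_generated_in; exists y.
rewrite mulrA -sy -!mulrA [LHS]rmorphM [RHS]rmorphM /= => /(mulrI su).
rewrite !rmorphM /= ja fword_shift //.
rewrite sl (shift_cartan sh_spec l_lin) mulrDl => /eqP.
rewrite -subr_eq0 addrAC subrr add0r mulr_algl scaler_eq0.
by case/orP => /eqP.
Qed.

Lemma quotient_image v : pV v = 0 -> p (j v) = 0.
Proof.
move=> /(V_quot.2 v).1 Nv; apply: (Nv [set v | p (j v) = 0]); split.
  split=> [|v1 v2 p1 p2|r v1 p1] /=; first by rewrite !linear0.
  - by rewrite !linearD /= p1 p2 addr0.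
  - by rewrite rmorphM pM p1 scaler0.
move=> _ [z gz <-] /=; apply/M_quot.2 => S [_]; apply.
by exists z.
Qed.

(** The Casimir operator sends the generator of U(g) / U(g) g_+ to its
    multiple by Omega_0 and commutes with u, so it sends u to u Omega_0. *)
Lemma casimir_image (u : U) :
  finite_set (DI `&` [set x | (fi x * ei x) *: p (j u) <> 0]) /\
  \sum_(x \in DI) (fi x * ei x) *: p (j u) =
    p (j u * j Omega0) - j Omega0 *: p (j u).
Proof.
have finZ := Omega_fin (pV u); set Z := [set x | _] in finZ.
have ZD : Z `<=` DI by move=> x [].
have outZ x : D (tag x) -> (fi x * ei x) *: p (j u) <> 0 -> Z x.
  move=> Dx px; split=> // px0; apply: px.
  rewrite -pM -!rmorphM; apply: quotient_image.
  by rewrite pVM.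
split; first by apply: sub_finite_set finZ => x [Dx px]; exact: outZ.
rewrite (fsum_finite finZ ZD outZ).
have := Omega_comm u (pV 1); rewrite /casimir /= -!pVM mulr1.
rewrite [X in _ = u *: (_ + X)]fsbig1; last first.
  move=> x Dx; rewrite -pVM mulr1; apply/V_quot.2 => S [[_ _ SM] gpS].
  by apply/SM/gpS; exists (e x) => //; case: e_basis => _ + _ _; exact.
rewrite addr0 -!pVM mulr1 (fsum_finite finZ ZD); last by move=> x Dx px; split.
move=> OE.
have : pV (Omega0 * u + \sum_(x <- fset_set Z) i (f x) * i (e x) * u - u * Omega0) = 0.
  rewrite linearB linearD linear_sum /= -OE.
  under eq_bigr do rewrite pVM.
  by rewrite subrr.
move/quotient_image; rewrite !(linearB, linearD, linear_sum) /=.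
rewrite !rmorphM pM => /eqP; rewrite subr_eq0 addrC => /eqP <-.
rewrite (pM (j Omega0)) addrK; apply: eq_bigr => x _.
by rewrite !rmorphM pM.
Qed.

(** Each f e commutes with fractions, so the formula passes to a fraction
    s^-1 a of U'(g). *)
Lemma casimir_verma (u : U') :
  finite_set (DI `&` [set x | (fi x * ei x) *: p u <> 0]) /\
  \sum_(x \in DI) (fi x * ei x) *: p u = p (u * j Omega0) - j Omega0 *: p u.
Proof.
case: U'_loc => _ /(_ u)[s [a [Xs ->]]] _.
have KsV : K (j s)^-1 by apply/KV/Kimage; case: Xs.
have KO : K (j Omega0) by exact: Kimage.
have feE x : D (tag x) ->
    (fi x * ei x) *: p ((j s)^-1 * j a) = (j s)^-1 *: ((fi x * ei x) *: p (j a)).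
  by move=> Dx; rewrite pM scalerA fe_shift // -scalerA.
have [finZ sumE] := casimir_image a.
split.
  apply: sub_finite_set finZ => x [Dx /= px]; split=> //= px0.
  by apply: px; rewrite feE // px0 scaler0.
transitivity (\sum_(x \in DI) (j s)^-1 *: ((fi x * ei x) *: p (j a))).
  by apply: eq_fsbigr => x; rewrite inE; exact: feE.
rewrite -scaler_fsum // sumE scalerBr -mulrA !(pM (j s)^-1).
by rewrite !scalerA (Kcomm KO KsV).
Qed.

Lemma psi_fraction l : linear_weight l -> K (psi sh (j Omega0) l).
Proof. by move=> l_lin; apply/KV/KB; [apply: shift_closed => //|]; exact: Kimage. Qed.

(** With w = e_n ... e_1 u of weight - mu, mu = l - (weight of s), the Casimir
    identity reads: the sum of f e w over all roots is
    (Omega_0^mu - Omega_0) w.  If mu = 0 this vanishes.  Otherwise psi_mu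
    inverts the scalar, unless w = 0, and then both sides are 0.  Moving
    psi_mu to the left of the f's shifts it by the weight of s. *)
Lemma casimir_descent l u s : linear_weight l -> weight_rep l u -> words DI s ->
  let t r := fe_monomial (j \o i \o e) (j \o i \o f) r *: p u in
  let b := weights_of s in
  if wsum b == l then \sum_(x \in DI) t (rcons s x) = 0
  else t s = sh (wsum b) (psi sh (j Omega0) (l - wsum b)) *:
             \sum_(x \in DI) t (rcons s x).
Proof.
move=> l_lin lu Ds /=; set b := weights_of s; set w := eword s * u.
have b_lin : linear_weight (wsum b) by exact: words_linear.
have lb_lin : linear_weight (l - wsum b).
  by apply: linear_weightD => //; exact: linear_weightN.
have lw : weight_rep (l - wsum b) w by exact: weight_rep_eword.
have KO : K (j Omega0) by exact: Kimage.
have [fin sumE] := casimir_verma w.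
have -> : \sum_(x \in DI)
    fe_monomial (j \o i \o e) (j \o i \o f) (rcons s x) *: p u =
    fword s *: ((sh (l - wsum b) (j Omega0) - j Omega0) *: p w).
  rewrite scalerBl -weight_rep_shift // -sumE scaler_fsum //.
  apply: eq_fsbigr => x _; rewrite /fe_monomial rev_rcons -cats1 big_cat big_seq1.
  by rewrite big_cons /w pM !scalerA !mulrA.
have [->|lb] := eqVneq (wsum b) l.
  by rewrite subrr shift0 // subrr scale0r scaler0.
have -> : fe_monomial (j \o i \o e) (j \o i \o f) s *: p u = fword s *: p w.
  by rewrite /fe_monomial -scalerA pM.
have [pw0|pw0] := pselect (p w = 0); first by rewrite pw0 !scaler0.
have KpsiV : K (psi sh (j Omega0) (l - wsum b)) by exact: psi_fraction.
rewrite !scalerA -fword_shift // -mulrA mulVr ?mulr1 //.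
apply: Kunit; first by apply: KB => //; exact: shift_closed.
apply: shift_Omega0_neq lw pw0 _ => //.
by move=> /eqP; rewrite subr_eq0 eq_sym; apply/negP.
Qed.

(** * The expansion of the projector *)

Lemma shift_prod l n (G : nat -> U') :
  linear_weight l -> (forall k, (k < n)%N -> K (G k)) ->
  sh l (\prod_(k < n) G k) = \prod_(k < n) sh l (G k).
Proof.
move=> l_lin; elim: n => [_|n IH GK]; first by rewrite !big_ord0 (shift1 sh_spec).
have GK' k : (k < n)%N -> K (G k) by move=> kn; apply: GK; exact: ltnW.
rewrite !big_ord_recr /= (shiftM sh_spec) ?IH //; last exact: GK.
elim: n {IH GK} GK' => [_|n IH GK]; first by rewrite big_ord0; exact: K1.
rewrite big_ord_recr /=; apply: KM; last exact: GK.
by apply: IH => k kn; apply: GK; exact: ltnW.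
Qed.

(** The factors of the shifted coefficient E of a suffix are the descent
    coefficients of [casimir_descent] along the prefixes of b, for
    l = wsum b. *)
Lemma shift_Ecoef b k : (forall l, l \in b -> D l) -> (k <= size b)%N ->
  sh (wsum (take k b)) (Ecoef sh (j Omega0) (drop k b)) =
  \prod_(k <= n < size b)
    sh (wsum (take n b)) (psi sh (j Omega0) (wsum b - wsum (take n b))).
Proof.
move=> Db kb.
have take_lin n c : (forall l, l \in c -> D l) -> linear_weight (wsum (take n c)).
  by move=> Dc; apply: (wsum_linear D_lin) => l /mem_take; exact: Dc.
have drop_lin n c : (forall l, l \in c -> D l) -> linear_weight (wsum (drop n c)).
  by move=> Dc; apply: (wsum_linear D_lin) => l /mem_drop; exact: Dc.
have Dd l : l \in drop k b -> D l by move=> /mem_drop; exact: Db.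
rewrite /Ecoef size_drop -[k in RHS]add0n big_addn big_mkord.
rewrite (shift_prod (G := fun n => sh (wsum (take n (drop k b)))
  (psi sh (j Omega0) (wsum (drop n (drop k b)))))); first last.
- by move=> n _; apply: shift_closed; [exact: take_lin|exact/psi_fraction/drop_lin].
- exact: take_lin.
apply: eq_bigr => n _; rewrite shiftD; [|exact: take_lin..|]; last first.
  exact/psi_fraction/drop_lin.
rewrite -wsum_cat -takeD drop_drop addnC; congr (sh _ (psi _ _ _)).
have -> : wsum b = wsum (take (n + k) b) + wsum (drop (n + k) b).
  by rewrite -wsum_cat cat_take_drop.
by rewrite addrAC subrr add0r.
Qed.

Section Expansion.
Variables (Dl : set (h -> F)).
Hypothesis Dl_levi : forall b : seq (h -> F), (forall l, l \in b -> D l) ->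
  cone Dl (wsum b) -> forall l, l \in b -> Dl l.
Hypothesis sums_fin : forall m : M,
  finite_set [set s : seq (rootindex I) |
    (forall x, x \in s -> D (tag x)) /\
    fe_monomial (j \o i \o e) (j \o i \o f) s *: m <> 0].

Local Notation fe := (fe_monomial (j \o i \o e) (j \o i \o f)).
Local Notation Pw s := (Pcoef sh (j Omega0) (cone Dl) (weights_of s)).

(** The right-hand side of the theorem as a single sum; the empty word
    contributes m itself. *)
Definition expansion (m : M) := \sum_(s \in words DI) Pw s *: (fe s *: m).

Lemma words_fin (m : M) : finite_set (words DI `&` [set s | fe s *: m <> 0]).
Proof. exact: sums_fin. Qed.

(** The telescope with words stopping at total weight l: there the carried
    coefficient is the sum in the recursion defining P, and the recursion says
    that it cancels P.  It applies because weights in the Levi cone would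
    add up to l in the Levi cone. *)
Lemma expansion_off_cone l u : linear_weight l -> weight_rep l u -> ~ cone Dl l ->
  expansion (p u) = 0.
Proof.
move=> l_lin lu nl.
pose c (s : seq (rootindex I)) :=
  sh (wsum (weights_of s)) (psi sh (j Omega0) (l - wsum (weights_of s))).
(* A s collects, from every proper prefix, its P times the descent
   coefficients met on the way from that prefix to s. *)
pose A s := \sum_(k < size s) Pw (take k s) * \prod_(k <= n < size s) c (take n s).
pose stop (s : seq (rootindex I)) := wsum (weights_of s) = l :> (h -> F).
apply: (telescope_words (t := fun s => fe s *: p u) (P := fun s => Pw s)
  (words_fin (p u)) (A := A) (c := c) (stop := stop)).
- by rewrite /A big_ord0.
- move=> s x; rewrite /A size_rcons big_ord_recr /=.
  rewrite mulrDl mulr_suml -cats1 take_size_cat // big_nat1 take_size_cat //.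
  congr (_ + _); apply: eq_bigr => -[k /= ks] _.
  rewrite take_cat ks big_nat_recr ?(ltnW ks) //= take_size_cat // mulrA.
  congr (_ * _ * _); apply: eq_big_nat => n /andP[_ ns].
  by rewrite take_cat ns.
- rewrite /stop => s Ds sl; split; last first.
    by have /= := casimir_descent l_lin lu Ds; rewrite sl eqxx.
  rewrite Pcoef_rec; last first.
    apply: contrapT => allc; apply: nl; rewrite -sl; apply: cone_wsum => m mb.
    by apply: contrapT => nm; apply: allc; exists m.
  rewrite addrC /A size_map; apply/eqP; rewrite subr_eq0; apply/eqP.
  apply: eq_bigr => -[k /= ks] _; rewrite {1}/weights_of map_take.
  congr (_ * _); rewrite shift_Ecoef; first last.
  + by rewrite size_map ltnW.
  + exact: words_weights.
  rewrite size_map sl; apply: eq_bigr => n _.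
  by rewrite /c /weights_of map_take.
- rewrite /stop => s Ds /eqP/negbTE sl; have /= := casimir_descent l_lin lu Ds.
  by rewrite sl.
Qed.

(** If the term of a nonempty word s does not vanish, then e_n ... e_1 u is a
    nonzero vector whose weight is minus a sum of positive roots.  These
    roots and those of s add up to l, so the Levi property puts all of them
    in the Levi part, where P(s) = 0. *)
Lemma expansion_on_cone l u : weight_rep l u -> cone Dl l -> expansion (p u) = p u.
Proof.
move=> lu cl; rewrite /expansion -(@fsbig_widen _ _ _ _ [set [::]]).
- rewrite fsbig_set1 Pcoef_nil scale1r /fe_monomial /= !big_nil mulr1 scale1r //.
- by move=> _ ->.
move=> s [Ds s0] /=.
have [pw0|pw0] := pselect (p (eword s * u) = 0).
  by rewrite /fe_monomial -[_ *: p u]scalerA -pM pw0 !scaler0.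
have [r [Dr rl _]] := weight_rep_support (weight_rep_eword Ds lu) pw0.
rewrite Pcoef_levi ?scale0r //; first by case: s s0 {Ds pw0 rl} => // s0; case: s0.
move=> m mb; exists [:: m]; split; last by rewrite /wsum big_seq1.
move=> _ /[1!inE] /eqP->.
apply: (Dl_levi (b := weights_of s ++ weights_of r)); last by rewrite mem_cat mb.
  by move=> n; rewrite mem_cat => /orP[]; exact: words_weights.
by rewrite wsum_cat rl addrC subrK.
Qed.

Lemma expansionD m n : expansion (m + n) = expansion m + expansion n.
Proof.
rewrite -fsumD; try exact/scale_words_fin/words_fin.
by apply: eq_fsbigr => s _; rewrite !scalerDr.
Qed.

(** Both sides are additive, so weight vectors suffice. *)
Lemma projector_expansion P m :
  relative_extremal_projector (j \o i \o inh) p D Dl P -> P m = expansion m.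
Proof.
move=> [PD PZ P1 P0]; have Lm := @fword_span_all m.
apply: (Lm [set m | P m = expansion m]); split.
  split=> [|m1 m2 /= e1 e2]; last by rewrite PD e1 e2 expansionD.
  have := PZ 0 0; rewrite scaler0 !scale0r /= => ->.
  by rewrite /expansion fsbig1 // => s _; rewrite !scaler0.
move=> _ [s [phi [Ds Kphi ->]]] /=.
set l := wsum (weights_of s); set u := fword s * phi.
have l_lin : linear_weight l by exact: words_linear.
have lu : weight_rep l u.
  rewrite -[l]add0r; apply: weight_rep_fword => //.
  by rewrite -[phi]mulr1; apply: weight_rep_fraction => //; exact: weight_rep1.
have lw := weight_rep_weight_space lu.
have [cl|ncl] := pselect (cone Dl l).
  by rewrite (expansion_on_cone lu) // (P1 l).
rewrite (expansion_off_cone l_lin lu) // (P0 l) //.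
by exists (weights_of s); split=> //; exact: words_weights.
Qed.

End Expansion.
End Casimir.
End Verma.

Theorem theorem4p1
  (F : fieldType) (F_char0 : [pchar F] =i pred0)
  (* g = g_- + h + g_+ *)
  (g : lmodType F) (par : bool -> set g) (br : g -> g -> g)
  (g_super : lie_superalgebra par br)
  (gm gp : set g) (h : lmodType F) (inh : {linear h -> g})
  (inh_inj : injective inh)
  (gm_sub : subsuperalgebra par br gm)
  (gp_sub : subsuperalgebra par br gp)
  (g_dec : direct_sum3 gm (range inh) gp)
  (* the Cartan subalgebra *)
  (h_even : range inh `<=` par false)
  (h_max : maximal_abelian par br (range inh))
  (* weight bases of g_+ and g_- *)
  (D : set (h -> F)) (D_lin : forall b, D b -> linear_weight b)
  (I : (h -> F) -> choiceType) (e f : rootindex I -> g)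
  (e_basis : is_basis [set x | D (tag x)] e gp)
  (f_basis : is_basis [set x | D (tag x)] f gm)
  (e_hom : forall x, D (tag x) -> exists b, par b (e x))
  (f_hom : forall x, D (tag x) -> exists b, par b (f x))
  (e_weight : forall x (y : h), D (tag x) -> br (inh y) (e x) = tag x y *: e x)
  (f_weight : forall x (y : h), D (tag x) ->
     br (inh y) (f x) = - (tag x y *: f x))
  (* U(g) and U(h) *)
  (U : algType F) (i : {linear g -> U}) (U_env : enveloping_algebra par br i)
  (Uh : set U) (Uh_def : Uh = subalgebra_generated (range (i \o inh)))
  (* the Casimir operator on V = U(g) / U(g) g_+ *)
  (V : lmodType U) (pV : {linear U^o -> V})
  (V_quot : quotient_map (left_ideal_generated (i @` gp)) pV)
  (Omega0 : U) (Omega0_h : Uh Omega0)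
  (Omega_fin : forall v : V,
     finite_set [set x | D (tag x) /\ (i (f x) * i (e x)) *: v <> 0])
  (Omega_comm : forall (u : U) (v : V),
     casimir D (i \o e) (i \o f) Omega0 (u *: v) =
     u *: casimir D (i \o e) (i \o f) Omega0 v)
  (* commuting with Omega_0 *)
  (Omega0_comm : forall u : U, u * Omega0 = Omega0 * u ->
     forall y : h, u * i (inh y) = i (inh y) * u)
  (* the order on h^* *)
  (order_antisym : forall l m : h -> F, wle D l m -> wle D m l -> l = m)
  (* U'(g), the shifts on U'(h), and M = U'(g) / U'(g) g_+ *)
  (U' : unitAlgType F) (j : {lrmorphism U -> U'})
  (U'_loc : ore_localization (nonzero Uh) j)
  (sh : (h -> F) -> U' -> U')
  (sh_spec : weight_shifts (fractions Uh j) (j \o i \o inh) sh)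
  (M : lmodType U') (p : {linear U'^o -> M})
  (M_quot : quotient_map (left_ideal_generated ((j \o i) @` gp)) p)
  (* the Levi data and the relative extremal projector *)
  (Dl : set (h -> F)) (Dl_sub : Dl `<=` D)
  (Dl_levi : forall b : seq (h -> F), (forall l, l \in b -> D l) ->
     cone Dl (wsum b) -> forall l, l \in b -> Dl l)
  (P : M -> M)
  (P_proj : relative_extremal_projector (j \o i \o inh) p D Dl P)
  (* pointwise finiteness of the infinite sums of operators on M *)
  (sums_fin : forall m : M,
     finite_set [set s : seq (rootindex I) |
       (forall x, x \in s -> D (tag x)) /\
       fe_monomial (j \o i \o e) (j \o i \o f) s *: m <> 0]) :
  forall m : M,
    P m = m +
      \sum_(l \in [set l : nat | (1 <= l)%N])
      \sum_(b \in [set b : seq (h -> F) |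
                    size b = l /\ forall x, x \in b -> D x])
        Pcoef sh (j Omega0) (cone Dl) b *:
        \sum_(s \in [set s : seq (rootindex I) | weights_of s = b])
          fe_monomial (j \o i \o e) (j \o i \o f) s *: m.
Proof.
have [_ h_abel _] := h_max; subst Uh => m.
rewrite (projector_expansion g_dec h_even h_abel D_lin e_basis f_basis e_hom f_hom
  e_weight f_weight U_env U'_loc sh_spec M_quot V_quot Omega0_h Omega_fin Omega_comm
  Omega0_comm Dl_levi sums_fin m P_proj).
rewrite /expansion /weights_of.
rewrite (fsum_words_fiber (k := tag) (D := D)
  (Pcoef sh (j Omega0) (cone Dl))); last exact: sums_fin.
by rewrite Pcoef_nil /fe_monomial !big_nil mulr1 !scale1r.
Qed.
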